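(* Let $z,z',w,w'\in\mathbb C$ satisfy $(z+k)(z'+k)>0$ and $(w+k)(w'+k)>0$ for all $k\in\mathbb Z$, and $z+z'+w+w'>-1$. Then the spectral $zw$-measure $M_{z,z',w,w'}$ is the unique invariant probability measure on $\Omega$ with respect to the semigroup $(P(t))_{t\ge0}$.
   Context: **Signatures.** For $N\ge1$, $\mathbb{GT}_N$ is the countable discrete set of signatures $\lambda=(\lambda_1\ge\dots\ge\lambda_N)\in\mathbb Z^N$, and $\mathrm{Dim}_N\lambda=\prod_{1\le i<j\le N}(\lambda_i-i-\lambda_j+j)\big/\prod_{i=1}^{N-1}i!$. **The space $\Omega$.** $\Omega$ is the closed subset of $\mathbb R_+^{4\infty+2}=(\mathbb R_+^\infty)^4\times\mathbb R_+\times\mathbb R_+$ (product topology, Borel $\sigma$-algebra) of sextuples $\omega=(\alpha^+,\beta^+,\alpha^-,\beta^-,\delta^+,\delta^-)$ with $\alpha^\pm=(\alpha^\pm_1\ge\alpha^\pm_2\ge\dots\ge0)$, $\beta^\pm=(\beta_1^\pm\ge\beta_2^\pm\ge\dots\ge0)$, $\sum_{i}(\alpha_i^\pm+\beta_i^\pm)\le\delta^\pm$, $\beta_1^++\beta_1^-\le1$. Put $\gamma^\pm=\delta^\pm-\sum_i(\alpha^\pm_i+\beta_i^\pm)\ge0$. For $|u|=1$ let $$\Phi_\omega(u)=e^{\gamma^+(u-1)+\gamma^-(u^{-1}-1)}\prod_{i=1}^\infty\frac{1+\beta_i^+(u-1)}{1-\alpha_i^+(u-1)}\,\frac{1+\beta_i^-(u^{-1}-1)}{1-\alpha_i^-(u^{-1}-1)}=\sum_{n\in\mathbb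 Z}\varphi_n(\omega)u^n .$$ The Markov kernel $\Lambda^\infty_N:\Omega\to\mathbb{GT}_N$ is $\Lambda^\infty_N(\omega,\lambda)=\mathrm{Dim}_N\lambda\cdot\det[\varphi_{\lambda_i-i+j}(\omega)]_{i,j=1}^N$. **The semigroups $P_N(t)$.** Put $u_N=z+N-1$, $u_N'=z'+N-1$, $v=w$, $v'=w'$. Let $\mathcal D^{(N)}$ be the matrix of transition rates on $\mathbb{GT}_N$ whose nonzero off-diagonal entries are, with $l_j=\lambda_j+N-j$ and $e_i$ the $i$-th standard basis vector, $$\mathcal D^{(N)}(\lambda,\lambda+e_i)=(l_i-u_N)(l_i-u'_N)\prod_{j\ne i}\frac{l_i+1-l_j}{l_i-l_j},\qquad \mathcal D^{(N)}(\lambda,\lambda-e_i)=(l_i+v)(l_i+v')\prod_{j\ne i}\frac{l_i-1-l_j}{l_i-l_j}$$ (when $\lambda\pm e_i\in\mathbb{GT}_N$), and whose diagonal entries make all row sums zero. $(P_N(t))_{t\ge0}$ is the Markov semigroup on $\mathbb{GT}_N$ with these transition rates: the minimal nonnegative solution of $\frac{d}{dt}P_N(t)=\mathcal D^{(N)}P_N(t)$, $P_N(0)=\mathrm{Id}$ (which is stochastic). **The semigroup $P(t)$.** $(P(t))_{t\ge0}$ is the unique Markov semigroup on $\Omega$ (family of Markov kernels $\Omega\to\Omega$ with $P(0)=1$, $P(s)P(t)=P(s+t)$) such that $P(t)\circ\Lambda^\infty_N=\Lambda^\infty_N\circ P_N(t)$ for all $t\ge0$, $N\ge1$. A probability measure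 $\mu$ on $\Omega$ is invariant if $\mu P(t)=\mu$ for all $t\ge0$, where $(\mu P(t))(A)=\int\mu(d\omega)P(t;\omega,A)$. **$zw$-measures.** The $N$th level $zw$-measure is the probability measure on $\mathbb{GT}_N$ $$M_{z,z',w,w'\mid N}(\lambda)=\mathrm{const}_N^{-1}\,(\mathrm{Dim}_N\lambda)^2\prod_{i=1}^N\frac1{\Gamma(z-\lambda_i+i)\Gamma(z'-\lambda_i+i)\Gamma(w+N+1+\lambda_i-i)\Gamma(w'+N+1+\lambda_i-i)},$$ with $\mathrm{const}_N$ the normalizing constant. The spectral $zw$-measure $M_{z,z',w,w'}$ is the unique probability measure on $\Omega$ with $M_{z,z',w,w'}\Lambda^\infty_N=M_{z,z',w,w'\mid N}$ for all $N\ge1$ (its existence and uniqueness are known). *)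

(* Defs.v *)
From HB Require Import structures.
From mathcomp Require Import all_boot all_order all_algebra complex.
From mathcomp Require Import all_classical all_reals all_analysis.
Set Implicit Arguments.
Unset Strict Implicit.
Unset Printing Implicit Defensive.
Import Order.TTheory GRing.Theory Num.Theory numFieldNormedType.Exports.
Local Open Scope classical_set_scope.
Local Open Scope ring_scope.
Local Open Scope complex_scope.

(* Indices start at 0 throughout: the i-th coordinate of the usual notation is
   the one of index i - 1. *)

(** Complex exponential and Gamma function *)

Definition cexp (R : realType) (s : R[i]) : R[i] :=
  (expR (complex.Re s))%:C * (cos (complex.Im s) +i* sin (complex.Im s)).

(* Euler-Gauss limit formula
     Gamma(s) = lim_n n! n^s / (s (s + 1) ... (s + n)),
   valid for every s other than 0, -1, -2, ... *)
Definition Gamma (R : realType) (s : R[i]) : R[i] :=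
  limn (fun n : nat =>
    (n`!%:R * cexp (s * (ln n%:R)%:C) / \prod_(k < n.+1) (s + k%:R)) : R[i]^o).

(** Signatures *)

Record GT (N : nat) := Signature {
  sigval :> {ffun 'I_N -> int};
  _ : [forall i : 'I_N, forall j : 'I_N, (i <= j)%N ==> (sigval j <= sigval i)] }.

HB.instance Definition _ N := [isSub for @sigval N].
HB.instance Definition _ N := [Choice of GT N by <:].

Lemma zero_signature N :
  [forall i : 'I_N, forall j : 'I_N, (i <= j)%N ==>
     ([ffun=> 0] j <= [ffun=> 0] i :> int)] :> bool.
Proof. by apply/'forall_forallP => i j; rewrite !ffunE lexx implybT. Qed.

HB.instance Definition _ N :=
  isPointed.Build (GT N) (Signature (zero_signature N)).
HB.instance Definition _ N := @isMeasurable.Build default_measure_display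
  (GT N) discrete_measurable discrete_measurable0
  discrete_measurableC discrete_measurableU.

Definition Dim (R : realType) N (l : GT N) : R :=
  (\prod_(i < N) \prod_(j < N | (i < j)%N) (l i - i%:Z - l j + j%:Z)%:~R)
  / \prod_(1 <= i < N) i`!%:R.

(** The space Omega, with the Borel sigma-algebra of the topology induced by
    the product topology *)

Definition ambient (R : realType) : topologicalType :=
  ({ptws nat -> R} * {ptws nat -> R} * {ptws nat -> R} * {ptws nat -> R}
   * R * R)%type.

Definition ambient_alphap (R : realType) (x : ambient R) : nat -> R :=
  x.1.1.1.1.1.
Definition ambient_betap (R : realType) (x : ambient R) : nat -> R :=
  x.1.1.1.1.2.
Definition ambient_alpham (R : realType) (x : ambient R) : nat -> R :=
  x.1.1.1.2.
Definition ambient_betam (R : realType) (x : ambient R) : nat -> R :=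
  x.1.1.2.
Definition ambient_deltap (R : realType) (x : ambient R) : R := x.1.2.
Definition ambient_deltam (R : realType) (x : ambient R) : R := x.2.

Definition nonincreasing_nonneg (R : realType) (a : nat -> R) : Prop :=
  nonincreasing_seq a /\ forall i, 0 <= a i.

Definition Omega_set (R : realType) : set (ambient R) := [set x |
  [/\ nonincreasing_nonneg (ambient_alphap x),
      nonincreasing_nonneg (ambient_betap x),
      nonincreasing_nonneg (ambient_alpham x) &
      nonincreasing_nonneg (ambient_betam x)]
  /\ [/\ (\sum_(0 <= i <oo) (ambient_alphap x i + ambient_betap x i)%:E
            <= (ambient_deltap x)%:E)%E,
         (\sum_(0 <= i <oo) (ambient_alpham x i + ambient_betam x i)%:E
            <= (ambient_deltam x)%:E)%E &
         ambient_betap x 0%N + ambient_betam x 0%N <= 1]].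
Arguments Omega_set R : clear implicits.

Definition ambient0 (R : realType) : ambient R :=
  (fun=> 0, fun=> 0, fun=> 0, fun=> 0, 0, 0).

Lemma Omega_set0 (R : realType) : ambient0 R \in Omega_set R.
Proof.
have nn : nonincreasing_nonneg (fun=> 0 : R) by split=> [m n _|]; rewrite lexx.
have s0 : (\sum_(0 <= i <oo) (0 + 0 : R)%:E <= 0%:E)%E.
  by rewrite addr0 eseries0.
by apply/mem_set; do 2!split => //; rewrite addr0 ler01.
Qed.

Definition Omega_top (R : realType) : Type := set_type (Omega_set R).

HB.instance Definition _ (R : realType) :=
  Topological.copy (Omega_top R) (set_type (Omega_set R)).
HB.instance Definition _ (R : realType) := isPointed.Build
  (Omega_top R) (exist _ (ambient0 R) (Omega_set0 R)).

Definition Omega (R : realType) := g_sigma_algebraType (@open (Omega_top R)).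

Section coordinates.
Context (R : realType).
Implicit Types om : Omega R.

Definition Omega_val om : ambient R := set_val (om : set_type (Omega_set R)).
Definition alphap om : nat -> R := ambient_alphap (Omega_val om).
Definition betap om : nat -> R := ambient_betap (Omega_val om).
Definition alpham om : nat -> R := ambient_alpham (Omega_val om).
Definition betam om : nat -> R := ambient_betam (Omega_val om).
Definition deltap om : R := ambient_deltap (Omega_val om).
Definition deltam om : R := ambient_deltam (Omega_val om).
Definition gammap om : R :=
  deltap om - fine (\sum_(0 <= i <oo) (alphap om i + betap om i)%:E)%E.
Definition gammam om : R :=
  deltam om - fine (\sum_(0 <= i <oo) (alpham om i + betam om i)%:E)%E.

Definition Phi om (u : R[i]) : R[i] :=
  cexp ((gammap om)%:C * (u - 1) + (gammam om)%:C * (u^-1 - 1)) *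
  limn (fun n : nat => (\prod_(i < n)
    ((1 + (betap om i)%:C * (u - 1)) / (1 - (alphap om i)%:C * (u - 1)) *
     ((1 + (betam om i)%:C * (u^-1 - 1)) /
      (1 - (alpham om i)%:C * (u^-1 - 1))))) : R[i]^o).

End coordinates.

(* [c] is the family of coefficients of an absolutely convergent expansion
   f(u) = sum_(n in Z) c_n u^n on the unit circle. *)
Definition laurent_expansion (R : realType) (f : R[i] -> R[i]) (c : int -> R) :
    Prop :=
  summable [set: int] (EFin \o c) /\
  forall u : R[i], `|u| = 1 ->
    (fun n : nat =>
       (\sum_(k < n) (c k%:Z)%:C * u ^ k%:Z +
        \sum_(k < n) (c (- k.+1%:Z))%:C * u ^ (- k.+1%:Z)) : R[i]^o)
      @ \oo --> (f u : R[i]^o).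

(* The density of the kernel Lambda^infty_N at [l], as a function of the
   Laurent coefficients [phi n = phi_n(omega)]. *)
Definition Lambda_entry (R : realType) N (phi : int -> R) (l : GT N) : R :=
  Dim R l * \det (\matrix_(i < N, j < N) phi (l i - i%:Z + j%:Z)).

(** The rate matrix on GT N *)

Section rates.
Context (R : realType) (z z' w w' : R[i]) (N : nat).
Implicit Types l m : GT N.

Definition lcoord l (j : 'I_N) : int := l j + N%:Z - j.+1%:Z.

(* Under the standing assumption on the parameters, (x - u_N)(x - u'_N) and
   (x + v)(x + v') are real for every integer x, so that taking the real part
   only changes the type. *)
Definition rate_up l (i : 'I_N) : R :=
  complex.Re (((lcoord l i)%:~R - (z + N%:R - 1)) *
              ((lcoord l i)%:~R - (z' + N%:R - 1))) *
  \prod_(j < N | j != i)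
    ((lcoord l i + 1 - lcoord l j)%:~R / (lcoord l i - lcoord l j)%:~R).

Definition rate_down l (i : 'I_N) : R :=
  complex.Re (((lcoord l i)%:~R + w) * ((lcoord l i)%:~R + w')) *
  \prod_(j < N | j != i)
    ((lcoord l i - 1 - lcoord l j)%:~R / (lcoord l i - lcoord l j)%:~R).

Definition std_vec (i : 'I_N) : {ffun 'I_N -> int} := [ffun j => (j == i)%:R].

Definition rate l m : R :=
  \sum_(i < N) ((if sigval m == sigval l + std_vec i then rate_up l i else 0)
              + (if sigval m == sigval l - std_vec i then rate_down l i else 0)).

(* The sum has finitely many nonzero terms. *)
Definition rate_matrix l m : R :=
  if m == l then - \sum_(k \in [set k | k != l]) rate l k else rate l m.

End rates.

(** Semigroup attached to a rate matrix with finitely supported rows *)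

Section minimal_solution.
Context (R : realType) (T : choiceType) (D : T -> T -> R).
Implicit Types p q : R -> T -> T -> R.

(* The derivative at time 0 is one-sided. *)
Definition nonneg_solution p : Prop :=
  [/\ forall t x y, 0 <= t -> 0 <= p t x y,
      forall x y, p 0 x y = (x == y)%:R &
      forall t x y, 0 <= t ->
        (fun s : R => (p s x y - p t x y) / (s - t))
          @ within [set s : R | 0 <= s] t^'
        --> \sum_(k \in [set: T]) D x k * p t k y].

Definition minimal_nonneg_solution p : Prop :=
  nonneg_solution p /\
  forall q, nonneg_solution q ->
    forall t x y, 0 <= t -> p t x y <= q t x y.

End minimal_solution.

Definition kernel_entry (R : realType) N
    (Q : R -> R.-pker (GT N) ~> (GT N)) (t : R) (l m : GT N) : R :=
  fine (Q t l [set m]).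

(** Markov semigroups on Omega *)

Section semigroup.
Context (R : realType).
Implicit Types P Q : R -> R.-pker (Omega R) ~> (Omega R).

Definition markov_semigroup P : Prop :=
  (forall om A, measurable A -> P 0 om A = \d_om A) /\
  forall s t om A, 0 <= s -> 0 <= t -> measurable A ->
    kcomp_noparam (P s) (P t) om A = P (s + t) om A.

Definition intertwines P (Lam : forall N, R.-pker (Omega R) ~> (GT N))
    (PN : forall N, R -> R.-pker (GT N) ~> (GT N)) : Prop :=
  forall t N om A, 0 <= t -> (0 < N)%N -> measurable A ->
    kcomp_noparam (P t) (Lam N) om A = kcomp_noparam (Lam N) (PN N t) om A.

Definition is_the_intertwining_semigroup
    (Lam : forall N, R.-pker (Omega R) ~> (GT N))
    (PN : forall N, R -> R.-pker (GT N) ~> (GT N)) P : Prop :=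
  [/\ markov_semigroup P, intertwines P Lam PN &
      forall Q, markov_semigroup Q -> intertwines Q Lam PN ->
        forall t om A, 0 <= t -> measurable A -> Q t om A = P t om A].

Definition invariant_measure P (mu : probability (Omega R) R) : Prop :=
  forall t A, 0 <= t -> measurable A ->
    (\int[mu]_om P t om A = mu A)%E.

End semigroup.

(** zw-measures *)

Section zw.
Context (R : realType) (z z' w w' : R[i]).

(* Real (indeed positive) under the standing assumption on the parameters. *)
Definition zw_weight N (l : GT N) : R[i] :=
  (Dim R l ^+ 2)%:C *
  \prod_(i < N)
    (Gamma (z - (l i)%:~R + i.+1%:R) * Gamma (z' - (l i)%:~R + i.+1%:R) *
     Gamma (w + N%:R + 1 + (l i)%:~R - i.+1%:R) *
     Gamma (w' + N%:R + 1 + (l i)%:~R - i.+1%:R))^-1.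

Definition zw_const N : R :=
  fine (\esum_(l in [set: GT N]) (complex.Re (zw_weight l))%:E).

Definition zw_mass N (l : GT N) : R :=
  (zw_const N)^-1 * complex.Re (zw_weight l).

Definition has_zw_projections (Lam : forall N, R.-pker (Omega R) ~> (GT N))
    (M : probability (Omega R) R) : Prop :=
  forall N (l : GT N), (0 < N)%N ->
    (\int[M]_om Lam N om [set l] = (zw_mass l)%:E)%E.

Definition is_the_spectral_zw_measure
    (Lam : forall N, R.-pker (Omega R) ~> (GT N))
    (M : probability (Omega R) R) : Prop :=
  has_zw_projections Lam M /\
  forall M' : probability (Omega R) R, has_zw_projections Lam M' ->
    forall A, measurable A -> M' A = M A.

End zw.

(* Main.v *)
From HB Require Import structures.
Require Import Defs.
From mathcomp Require Import all_boot all_order all_algebra complex.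
From mathcomp Require Import all_classical all_reals all_analysis.
From mathcomp Require Import measurable_realfun finmap zify ring lra.
Import Order.TTheory GRing.Theory Num.Theory numFieldNormedType.Exports.
Local Open Scope classical_set_scope.
Local Open Scope ring_scope.
Local Open Scope complex_scope.
Set Implicit Arguments.
Unset Strict Implicit.
Unset Printing Implicit Defensive.

(** Everything is reduced to the chains on the discrete sets of signatures.  Let mu be
    a probability measure on Omega and mu_N its projection to level N.  By the
    intertwining relation, the projection of mu P(t) is mu_N P_N(t)
    ([projection_evolution]), and M is characterized by its projections, the
    zw-measures M_N.  Hence M is invariant as soon as M_N is invariant under P_N for
    every N.  Conversely, if mu is invariant then so is each mu_N, and mu = M as
    soon as M_N is the only invariant law of P_N.

    Invariance of M_N ([zw_mass_invariant]).  The zw-measure is in detailed balance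
    with the rates ([rate_matrix_reversible]): when a box is added in one row, the
    functional equation of the Gamma function ([Gamma_shift]) yields the quadratic
    factors of the rates, and the squared dimension yields the products of
    differences.  As the rates are unbounded, it must still be shown that the
    transition function inherits this symmetry, which is
    [minimal_solution_reversible].  For that, kill the chain outside a finite window
    and discretize time: the powers of I + D_F / m are nonnegative, substochastic
    and symmetric with respect to the reversible weight, and they satisfy a
    second-order Taylor estimate that does not depend on the window or on the mesh.
    Their limit along an ultrafilter therefore is a nonnegative, substochastic,
    symmetric solution of the backward equation.  It dominates the minimal
    solution, which is stochastic, so the two coincide.

    Uniqueness ([invariant_mass_unique]).  Any two signatures are joined by a path
    of jumps with positive rates ([sig_connected]).  If mu and nu are invariant, so
    is their minimum m, and by irreducibility the invariant mass mu - m is either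
    0 or positive everywhere; in both cases mu and nu are comparable, hence
    equal. *)

(** * Sums with finite support and sums of nonnegative families *)

Section finite_support_sums.
Context (R : realType) (T : choiceType).
Implicit Types (F s : seq T) (f : T -> R).

Lemma big_inter_support F s f : uniq F -> uniq s ->
  (forall z, f z != 0 -> z \in s) ->
  \sum_(z <- F) f z = \sum_(z <- s | z \in F) f z.
Proof.
move=> uF us fs.
rewrite [LHS](bigID (mem s))/= [X in _ + X]big1 ?addr0; last first.
  by move=> z zs; apply/eqP; apply: contraNT zs; exact: fs.
rewrite -big_filter -[RHS]big_filter; apply: perm_big.
apply: uniq_perm; rewrite ?filter_uniq// => z.
by rewrite !mem_filter andbC.
Qed.

Lemma big_support_sub F s f : uniq F -> uniq s ->
  (forall z, f z != 0 -> z \in s) -> {subset s <= F} ->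
  \sum_(z <- F) f z = \sum_(z <- s) f z.
Proof.
move=> uF us fs sF; rewrite (big_inter_support uF us fs).
rewrite big_seq_cond [RHS]big_seq_cond; apply: eq_bigl => z.
by case zs: (z \in s) => //=; rewrite (sF _ zs).
Qed.

Lemma ler_big_support F s f : uniq F -> uniq s ->
  (forall z, f z != 0 -> z \in s) -> (forall z, 0 <= f z) ->
  \sum_(z <- F) f z <= \sum_(z <- s) f z.
Proof.
move=> uF us fs f0; rewrite (big_inter_support uF us fs).
by rewrite [leRHS](bigID (mem F))/= lerDl sumr_ge0.
Qed.

Lemma fsbig_support s f : uniq s -> (forall z, f z != 0 -> z \in s) ->
  \sum_(z \in [set: T]) f z = \sum_(z <- s) f z.
Proof.
move=> us fs; rewrite (fsbigE s)//=; first by apply: eq_bigl => z; rewrite in_setT.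
by move=> z _ zs; apply/eqP; apply: contraNT zs; exact: fs.
Qed.

End finite_support_sums.

Lemma esum_fin_le (R : realType) (T : choiceType) (f : T -> R) (c : R) :
  (forall S : seq T, uniq S -> \sum_(y <- S) f y <= c) ->
  (\esum_(y in [set: T]) (f y)%:E <= c%:E)%E.
Proof.
move=> fc; apply: ge_ereal_sup => _ [A [finA _] <-].
by rewrite fsbig_finite//= sumEFin lee_fin; exact: fc.
Qed.

(** Two comparable families with the same finite total coincide.  It turns
    inequalities between (sub)stochastic kernels into equalities. *)
Lemma esum_le_eq (R : realType) (T : choiceType) (a b : T -> R) :
  (forall y, 0 <= a y) -> (forall y, a y <= b y) ->
  (\esum_(y in [set: T]) (b y)%:E <= \esum_(y in [set: T]) (a y)%:E)%E ->
  (\esum_(y in [set: T]) (a y)%:E < +oo)%E ->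
  forall y, a y = b y.
Proof.
move=> a0 ab ba aoo y; apply/eqP; rewrite eq_le ab/=.
have b0 z : 0 <= b z by exact: le_trans (a0 z) (ab z).
have split_y (f : T -> R) : (forall z, 0 <= f z) ->
    (\esum_(z in [set: T]) (f z)%:E =
     (f y)%:E + \esum_(z in ~` [set y]) (f z)%:E)%E.
  move=> f0; rewrite (esumID [set y])//; last by move=> z _; rewrite lee_fin.
  by rewrite !setTI esum_set1// lee_fin.
move: ba aoo; rewrite !split_y//.
have rab : (\esum_(z in ~` [set y]) (a z)%:E <= \esum_(z in ~` [set y]) (b z)%:E)%E.
  by apply: le_esum => z _; rewrite lee_fin.
have : (0 <= \esum_(z in ~` [set y]) (a z)%:E)%E.
  by apply: esum_ge0 => z _; rewrite lee_fin.
move: rab; case: (\esum_(z in _) (a z)%:E)%E => //= r.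
case: (\esum_(z in _) (b z)%:E)%E => //= s.
by rewrite !lee_fin; lra.
Qed.

Lemma ge0_esumZl (R : realType) (T : choiceType) (c : R) (f : T -> \bar R) :
  0 <= c -> (forall x, 0%:E <= f x)%E ->
  (\esum_(x in [set: T]) (c%:E * f x) = c%:E * \esum_(x in [set: T]) f x)%E.
Proof.
move=> c0 f0; rewrite /esum -ereal_supZl//; last first.
  by apply/set0P; exists (\sum_(x \in set0) f x)%E; exists set0 => //; exact: fsets_set0.
congr ereal_sup; rewrite image_comp; apply: eq_imagel => A [finA _] /=.
by rewrite ge0_mule_fsumr.
Qed.

Lemma esum_exchange (R : realType) (T T' : choiceType) (f : T -> T' -> \bar R) :
  (forall x y, 0%:E <= f x y)%E ->
  (\esum_(x in [set: T]) \esum_(y in [set: T']) f x y =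
   \esum_(y in [set: T']) \esum_(x in [set: T]) f x y)%E.
Proof.
move=> f0; rewrite !esum_esum//.
have setX2 (A B : choiceType) : [set: A] `*`` (fun=> [set: B]) = setT.
  by apply/seteqP; split.
rewrite !setX2 (@reindex_esum _ _ _ [set: T' * T] setT
  (fun k : T' * T => (k.2, k.1)) (fun k => f k.1 k.2))//=.
split=> [k _ //|k l _ _ [] |[x y] _].
  by case: k l => [? ?] [? ?] /= -> ->.
by exists (y, x).
Qed.

(** * The Euler scheme of a truncated rate matrix *)

Section euler_scheme.
Context (R : realType) (T : choiceType) (D : T -> T -> R) (nb : T -> seq T).
Hypothesis D_offdiag : forall x y, x != y -> 0 <= D x y.
Hypothesis nb_uniq : forall x, uniq (nb x).
Hypothesis nb_supp : forall x y, D x y != 0 -> y \in nb x.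
Hypothesis D_row0 : forall x, \sum_(y <- nb x) D x y = 0.
Context (F : seq T) (m : R).
Hypothesis uF : uniq F.
Hypothesis m_gt0 : 0 < m.
Hypothesis m_ge : forall x, x \in F -> - D x x <= m.

Let mV_ge0 : 0 <= m^-1. Proof. by rewrite invr_ge0 ltW. Qed.

(** The generator killed outside the window [F], applied on the left of a
    kernel.  Killing, rather than any other boundary condition, keeps the
    kernel symmetric with respect to every reversible weight of [D] and only
    loses mass. *)
Definition truncated_gen (A : T -> T -> R) x y : R :=
  (x \in F)%:R * \sum_(z <- F) D x z * A z y.

Definition euler_step (A : T -> T -> R) x y : R :=
  A x y + m^-1 * truncated_gen A x y.

(** The [k]-th power of I + D_F / m.  As soon as the mesh parameter [m]
    dominates the diagonal of [D] on [F] this matrix is substochastic, so that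
    its powers are a probabilistic approximation of the killed semigroup. *)
Definition euler k : T -> T -> R :=
  iter k euler_step (fun x y => (x == y)%:R).

Lemma eulerS k x y :
  euler k.+1 x y = euler k x y + m^-1 * truncated_gen (euler k) x y.
Proof. by []. Qed.

Lemma eulerS_in k x y : x \in F -> euler k.+1 x y =
  (1 + m^-1 * D x x) * euler k x y +
  m^-1 * \sum_(z <- F | z != x) D x z * euler k z y.
Proof.
move=> xF; rewrite eulerS /truncated_gen xF mul1r (bigD1_seq x)//=.
ring.
Qed.

(** This is where the step 1/m has to be small compared with the rates in the
    window. *)
Lemma euler_diag_ge0 x : x \in F -> 0 <= 1 + m^-1 * D x x.
Proof.
move=> /m_ge; rewrite -(ler_pM2l (_ : 0 < m^-1)) ?invr_gt0// mulVf ?gt_eqF//.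
by rewrite mulrN; lra.
Qed.

Lemma euler_ge0 k x y : 0 <= euler k x y.
Proof.
elim: k x => [x|k IH x]; first by rewrite /euler /= ler0n.
have [xF|xF] := boolP (x \in F); last first.
  by rewrite eulerS /truncated_gen (negbTE xF) mul0r mulr0 addr0.
rewrite eulerS_in// addr_ge0//; first by rewrite mulr_ge0// euler_diag_ge0.
rewrite mulr_ge0// sumr_ge0// => z zx.
by rewrite mulr_ge0// D_offdiag// eq_sym.
Qed.

(** The full row sums vanish and the entries dropped by the truncation are
    off-diagonal, hence nonnegative. *)
Lemma truncated_row_le0 x : x \in F -> \sum_(z <- F) D x z <= 0.
Proof.
move=> xF; rewrite (bigD1_seq x)//= -[leRHS](D_row0 x).
have := @ler_big_support R T F (nb x) (fun z => if z != x then D x z else 0)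
  uF (nb_uniq x).
rewrite -!big_mkcond/= => H.
have {}H : \sum_(z <- F | z != x) D x z <= \sum_(z <- nb x | z != x) D x z.
  apply: H => z; case: ifPn => //; rewrite ?eqxx// => zx; first exact: nb_supp.
  by rewrite D_offdiag// eq_sym.
have [xn|xn] := boolP (x \in nb x).
  by rewrite [leRHS](bigD1_seq x)//= lerD2l; exact: H.
have D0 : D x x = 0 by apply/eqP; apply: contraNT xn; exact: nb_supp.
rewrite D0 add0r; apply: (le_trans H); rewrite [leRHS](bigID (predC1 x))/=.
rewrite lerDl big1 // => z /negPn/eqP -> //.
Qed.

Lemma euler_sum_le1 k x (S : seq T) : uniq S -> \sum_(y <- S) euler k x y <= 1.
Proof.
move=> uS; elim: k x => [x|k IH x].
  have [xS|xS] := boolP (x \in S).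
    rewrite (bigD1_seq x)//= eqxx big1 ?addr0// => y yx.
    by rewrite eq_sym (negbTE yx).
  rewrite big1_seq// => y /andP[_ yS]; rewrite /euler/=.
  by case: eqP => // xy; rewrite xy yS in xS.
have [xF|xF] := boolP (x \in F); last first.
  under eq_bigr do
    rewrite eulerS /truncated_gen (negbTE xF) mul0r mulr0 addr0.
  exact: IH.
under eq_bigr do rewrite eulerS_in//.
rewrite big_split/= -!mulr_sumr exchange_big/=.
under [in X in _ + X]eq_bigr do rewrite -mulr_sumr.
apply: (@le_trans _ _ ((1 + m^-1 * D x x) * 1 +
   m^-1 * \sum_(z <- F | z != x) D x z * 1)).
  rewrite lerD//; first by rewrite ler_wpM2l// euler_diag_ge0.
  rewrite ler_wpM2l// ?mV_ge0//; apply: ler_sum => z zx.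
  by rewrite ler_wpM2l// D_offdiag// eq_sym.
have := truncated_row_le0 xF; rewrite (bigD1_seq x)//= => H.
under [in X in _ + X]eq_bigr do rewrite mulr1.
rewrite mulr1 -addrA -mulrDr gerDl mulr_ge0_le0//.
Qed.

Lemma euler_le1 k x y : euler k x y <= 1.
Proof. by have := @euler_sum_le1 k x [:: y] isT; rewrite big_seq1. Qed.

(** A matrix commutes with its own powers; this is what allows time to be
    reversed in the next lemma. *)
Lemma eulerSr k x y : euler k.+1 x y = euler k x y +
  m^-1 * ((y \in F)%:R * \sum_(z <- F) euler k x z * D z y).
Proof.
elim: k x => [x|k IH x].
  rewrite eulerS /truncated_gen /euler/=; congr (_ + _ * _).
  have [xF|xF] := boolP (x \in F); have [yF|yF] := boolP (y \in F).
  - rewrite (bigD1_seq y)//= [in RHS](bigD1_seq x)//= !eqxx !mul1r !mulr1.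
    rewrite !big1// => z zx; first by rewrite eq_sym (negbTE zx) mul0r.
    by rewrite (negbTE zx) mulr0.
  - rewrite mul0r mul1r big1_seq// => z /andP[_ zF].
    by case: eqP => [zy|]; rewrite ?mulr0// -zy zF in yF *.
  - rewrite mul0r mul1r big1_seq// => z /andP[_ zF].
    by case: eqP => [zy|]; rewrite ?mul0r// zy zF in xF *.
  - by rewrite !mul0r.
rewrite eulerS {1}IH [in RHS]eulerS.
have -> : truncated_gen (euler k.+1) x y = truncated_gen (euler k) x y +
   m^-1 * ((y \in F)%:R * \sum_(z <- F) truncated_gen (euler k) x z * D z y).
  rewrite {1}/truncated_gen.
  under eq_bigr do rewrite IH mulrDr.
  rewrite big_split/= mulrDr -/(truncated_gen (euler k) x y); congr (_ + _).
  pose S := \sum_(z <- F) \sum_(w <- F) D x z * euler k z w * D w y.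
  transitivity (m^-1 * ((x \in F)%:R * ((y \in F)%:R * S))).
    rewrite [RHS]mulrCA; congr (_ * _); rewrite /S !mulr_sumr.
    apply: eq_bigr => z _; rewrite !mulr_sumr.
    by apply: eq_bigr => w _; ring.
  congr (_ * _); rewrite [LHS]mulrCA; congr (_ * _).
  rewrite /S exchange_big/= mulr_sumr; apply: eq_bigr => w _.
  by rewrite /truncated_gen !mulr_sumr mulr_suml; apply: eq_bigr => z _; ring.
under [in RHS]eq_bigr do rewrite eulerS mulrDl -mulrA.
rewrite big_split/= -mulr_sumr; ring.
Qed.

(** Detailed balance passes from a matrix to its powers: one step on the left
    becomes one step on the right. *)
Lemma euler_sym (pi : T -> R) :
  (forall x y, pi x * D x y = pi y * D y x) ->
  forall k x y, pi x * euler k x y = pi y * euler k y x.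
Proof.
move=> piD; elim => [x y|k IH x y].
  by rewrite /euler/= eq_sym; case: eqP => [->|] //; rewrite !mulr0.
rewrite eulerS eulerSr !mulrDr IH; congr (_ + _).
rewrite /truncated_gen !mulr_sumr; apply: eq_bigr => z _.
transitivity (m^-1 * (x \in F)%:R * (pi x * D x z) * euler k z y); first ring.
transitivity (m^-1 * (x \in F)%:R * (pi z * euler k z y) * D z x).
  by rewrite piD; ring.
by rewrite IH; ring.
Qed.

Definition row_norm x : R := \sum_(z <- nb x) `|D x z|.
(** A bound for the row of D^2 at [x], hence for second time derivatives; it
    does not depend on the window. *)
Definition row_norm2 x : R := \sum_(z <- nb x) `|D x z| * row_norm z.

Lemma row_norm_ge0 x : 0 <= row_norm x.
Proof. exact: sumr_ge0. Qed.

Lemma truncated_gen_diff_le A A' x y (b : T -> R) : (forall z, 0 <= b z) ->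
  (forall z, `|A z y - A' z y| <= b z) ->
  `|truncated_gen A x y - truncated_gen A' x y| <=
    \sum_(z <- nb x) `|D x z| * b z.
Proof.
move=> b0 Ab; rewrite /truncated_gen -mulrBr -sumrB normrM.
apply: (@le_trans _ _ (\sum_(z <- F) `|D x z| * b z)).
  rewrite -[leRHS]mul1r ler_pM//; first by rewrite normr_nat lern1 leq_b1.
  apply: (le_trans (ler_norm_sum _ _ _)); apply: ler_sum => z _.
  by rewrite -mulrBr normrM ler_wpM2l.
apply: ler_big_support => // z; last by rewrite mulr_ge0.
by rewrite mulf_eq0 negb_or normr_eq0 => /andP[/nb_supp].
Qed.

Lemma truncated_gen_le k x y : `|truncated_gen (euler k) x y| <= row_norm x.
Proof.
have -> : truncated_gen (euler k) x y =
    truncated_gen (euler k) x y - truncated_gen (fun _ _ => 0) x y.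
  by rewrite [X in _ - X]/truncated_gen big1 ?mulr0 ?subr0// => z _; rewrite mulr0.
have -> : row_norm x = \sum_(z <- nb x) `|D x z| * 1.
  by apply: eq_bigr => z _; rewrite mulr1.
apply: truncated_gen_diff_le => // z.
by rewrite subr0 ger0_norm ?euler_ge0 ?euler_le1.
Qed.

Lemma euler_lip k j x y :
  `|euler (k + j) x y - euler k x y| <= j%:R / m * row_norm x.
Proof.
elim: j => [|j IH]; first by rewrite addn0 subrr normr0 mul0r mul0r.
rewrite addnS eulerS addrAC; apply: (le_trans (ler_normD _ _)).
rewrite -natr1 !mulrDl lerD// mul1r normrM ger0_norm ?mV_ge0//.
by rewrite ler_wpM2l ?truncated_gen_le.
Qed.

(** A Taylor formula in discrete time, with a remainder that does not depend on
    the window or on the mesh.  This uniformity is what survives in the limit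
    and yields the differential equation there. *)
Lemma euler_taylor k j x y :
  `|euler (k + j) x y - euler k x y - j%:R / m * truncated_gen (euler k) x y|
    <= (j%:R / m) ^+ 2 * row_norm2 x.
Proof.
elim: j => [|j IH].
  by rewrite addn0 subrr mul0r mul0r subr0 normr0 expr2 !mul0r.
rewrite addnS eulerS.
set A := truncated_gen (euler (k + j)) x y.
set B := truncated_gen (euler k) x y in IH *.
have AB : `|A - B| <= j%:R / m * row_norm2 x.
  rewrite /row_norm2 mulr_sumr.
  apply: (le_trans (@truncated_gen_diff_le _ _ x y
     (fun z => j%:R / m * row_norm z) _ _)).
  - by move=> z; rewrite mulr_ge0 ?row_norm_ge0// divr_ge0// ltW.
  - by move=> z; exact: euler_lip.
  by apply: ler_sum => z _; rewrite mulrCA.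
rewrite [X in `|X|](_ : _ = (euler (k + j) x y - euler k x y - j%:R / m * B)
   + m^-1 * (A - B)); last by rewrite -natr1; ring.
apply: (le_trans (ler_normD _ _)).
apply: (le_trans (lerD IH (_ : _ <= m^-1 * (j%:R / m * row_norm2 x)))).
  by rewrite normrM ger0_norm ?mV_ge0// ler_wpM2l.
have r0 : 0 <= row_norm2 x.
  by apply: sumr_ge0 => z _; rewrite mulr_ge0// row_norm_ge0.
rewrite mulrA -mulrDl ler_wpM2r// -natr1.
have j0 : 0 <= j%:R :> R by [].
rewrite -subr_ge0 (_ : _ - _ = j%:R * m^-1 * m^-1 + m^-1 * m^-1); last by ring.
by rewrite addr_ge0// ?mulr_ge0.
Qed.

End euler_scheme.

(** * Limits of Euler schemes *)

(** Limits along an ultrafilter replace the extraction of convergent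
    subsequences: all the entries converge at once, at all times. *)
Lemma ultra_bounded_cvg (R : realType) (I : Type) (U : set_system I)
    (f : I -> R) (a b : R) : UltraFilter U -> (forall i, a <= f i <= b) ->
  cvg (f i @[i --> U]).
Proof.
move=> UU fab; have PU := ultra_proper.
have UfU : UltraFilter (f @ U).
  split; first exact: fmap_proper_filter.
  move=> G PG fUG; apply/seteqP; split=> // A GA.
  have [//|UA] := in_ultra_setVsetC (f @^-1` A) UU.
  have GAC : G (~` A) by exact: fUG UA.
  have GAA : G (A `&` ~` A) by exact: filterI.
  by have [x []] := filter_ex GAA.
have : compact `[a, b] by exact: segment_compact.
rewrite compact_ultra => /(_ _ UfU)[|l [_ fl]]; last by apply/cvg_ex; exists l.
by apply: nearW => i; rewrite /= in_itv/=.
Qed.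

Section euler_limit.
Context (R : realType) (T : countType) (D : T -> T -> R) (nb : T -> seq T).
Hypothesis D_offdiag : forall x y, x != y -> 0 <= D x y.
Hypothesis nb_uniq : forall x, uniq (nb x).
Hypothesis nb_supp : forall x y, D x y != 0 -> y \in nb x.
Hypothesis D_row0 : forall x, \sum_(y <- nb x) D x y = 0.

Let window n : seq T := undup (pmap choice.unpickle (iota 0 n)).

Let window_uniq n : uniq (window n). Proof. exact: undup_uniq. Qed.

Let window_exhausts x : \forall n \near \oo, x \in window n.
Proof.
exists (choice.pickle x).+1 => // n /= xn; rewrite mem_undup mem_pmap.
by apply/mapP; exists (choice.pickle x); rewrite ?mem_iota ?choice.pickleK.
Qed.

(** The first summand makes the step tend to 0, the second one dominates the
    rates in the window. *)
Let mesh n : R := n.+1%:R + \sum_(x <- window n) `|D x x|.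

Let mesh_ge n : n.+1%:R <= mesh n.
Proof. by rewrite lerDl sumr_ge0. Qed.

Let mesh_gt0 n : 0 < mesh n.
Proof. exact: lt_le_trans (mesh_ge n). Qed.

Let mesh_dom n x : x \in window n -> - D x x <= mesh n.
Proof.
move=> xF; rewrite /mesh (bigD1_seq x)//=.
apply: (@le_trans _ _ `|D x x|); first by rewrite -normrN ler_norm.
by rewrite addrCA lerDl addr_ge0// sumr_ge0.
Qed.

Let steps n t : nat := Num.truncn (t * mesh n).

Let approx n t := euler D (window n) (mesh n) (steps n t).

Let approx01 n t x y : 0 <= approx n t x y <= 1.
Proof.
by rewrite euler_ge0 ?(euler_le1 D_offdiag nb_uniq nb_supp D_row0)//; exact: mesh_dom.
Qed.

Let steps_mono n s t : s <= t -> (steps n s <= steps n t)%N.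
Proof. by move=> st; apply: le_truncn; rewrite ler_wpM2r// ltW. Qed.

Let steps_cvg s t : 0 <= s -> s <= t ->
  (steps n t - steps n s)%:R / mesh n @[n --> \oo] --> t - s.
Proof.
move=> s0 st; apply/cvgrPdist_le => e e0.
have : harmonic n @[n --> \oo] --> (0 : R) by exact: cvg_harmonic.
move=> /cvgr0Pnorm_le/(_ _ e0); apply: filterS => n.
rewrite /harmonic/= ger0_norm// => ne; apply: le_trans ne.
rewrite natrB ?steps_mono//.
have M0 := mesh_gt0 n; set M := mesh n in M0 *.
have h u : 0 <= u -> (steps n u)%:R <= u * M < (steps n u)%:R + 1.
  by move=> u0; rewrite natr1; apply: truncn_itv; rewrite mulr_ge0// ltW.
have /andP[s1 s2] := h _ s0; have /andP[t1 t2] := h _ (le_trans s0 st).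
have -> : t - s - ((steps n t)%:R - (steps n s)%:R) / M =
    ((t * M - (steps n t)%:R) - (s * M - (steps n s)%:R)) / M.
  by field; rewrite gt_eqF.
rewrite normrM [X in _ * X]ger0_norm; last by rewrite invr_ge0 ltW.
apply: (@le_trans _ _ (1 / M)).
  by rewrite ler_pM2r ?invr_gt0// ler_norml; apply/andP; split; lra.
by rewrite div1r lef_pV2 ?posrE.
Qed.

Context (U : set_system nat).
Hypothesis UU : UltraFilter U.
Hypothesis U_oo : \oo `<=` U.

Local Instance U_proper : ProperFilter U.
Proof. exact: ultra_proper. Qed.

Definition euler_lim t x y : R := lim (approx n t x y @[n --> U]).

Let approx_cvg t x y : approx n t x y @[n --> U] --> euler_lim t x y.
Proof. exact: (ultra_bounded_cvg UU (fun n => approx01 n t x y)). Qed.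

Lemma euler_lim_ge0 t x y : 0 <= euler_lim t x y.
Proof.
apply: (ler_cvg_to (cvg_cst 0) (@approx_cvg t x y)).
by apply: nearW => n; case/andP: (approx01 n t x y).
Qed.

Lemma euler_lim_sum_le1 t x (S : seq T) : uniq S ->
  \sum_(y <- S) euler_lim t x y <= 1.
Proof.
move=> uS.
have c : \sum_(y <- S) approx n t x y @[n --> U] --> \sum_(y <- S) euler_lim t x y.
  by apply: cvg_big => [|y _]; [exact: add_continuous|]; exact: approx_cvg.
apply: (ler_cvg_to c (cvg_cst (1 : R))); apply: nearW => n.
by apply: (euler_sum_le1 D_offdiag nb_uniq nb_supp D_row0) => //; exact: mesh_dom.
Qed.

Lemma euler_lim_sym (pi : T -> R) :
  (forall x y, pi x * D x y = pi y * D y x) ->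
  forall t x y, pi x * euler_lim t x y = pi y * euler_lim t y x.
Proof.
move=> piD t x y.
have c1 : pi x * approx n t x y @[n --> U] --> pi x * euler_lim t x y.
  exact: cvgM (cvg_cst _) (@approx_cvg t x y).
have c2 : pi y * approx n t y x @[n --> U] --> pi y * euler_lim t y x.
  exact: cvgM (cvg_cst _) (@approx_cvg t y x).
rewrite -(cvg_lim _ c1)// -(cvg_lim _ c2)//; congr (lim (_ @ U)).
by apply/funext => n; exact: euler_sym.
Qed.

Lemma euler_lim0 x y : euler_lim 0 x y = (x == y)%:R.
Proof.
rewrite /euler_lim (_ : (fun n => _) = fun=> (x == y)%:R); first exact: lim_cst.
by apply/funext => n; rewrite /approx /steps mul0r truncn0.
Qed.

Let gen t x y : R := \sum_(z <- nb x) D x z * euler_lim t z y.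

(** A row of [D] has finite support, hence it is eventually inside the window,
    and the truncation is no longer visible at [x]. *)
Let gen_cvg t x y :
  truncated_gen D (window n) (approx n t) x y @[n --> U] --> gen t x y.
Proof.
have c : \sum_(z <- nb x) D x z * approx n t z y @[n --> U] --> gen t x y.
  apply: cvg_big => [|z _]; first exact: add_continuous.
  exact: cvgM (cvg_cst _) (@approx_cvg t z y).
apply: cvg_trans c; apply: near_eq_cvg; apply: U_oo.
have : \forall n \near \oo, {subset nb x <= window n}.
  elim: (nb x) => [|z s IH]; first exact: nearW.
  move: (window_exhausts z) IH; apply: filterS2 => n zn sn w.
  by rewrite inE => /predU1P[->//|]; exact: sn.
apply: filter_app; have := window_exhausts x; apply: filterS => n xF sF.
rewrite /truncated_gen xF mul1r.
apply/esym; apply: big_support_sub => // z.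
rewrite mulf_eq0 negb_or => /andP[+ _].
exact: nb_supp.
Qed.

Lemma euler_lim_lip s t x y : 0 <= s -> s <= t ->
  `|euler_lim t x y - euler_lim s x y| <= (t - s) * row_norm D nb x.
Proof.
move=> s0 st.
have c1 : `|approx n t x y - approx n s x y| @[n --> U] -->
    `|euler_lim t x y - euler_lim s x y|.
  by apply: cvg_norm; apply: cvgB; exact: approx_cvg.
have c2 : (steps n t - steps n s)%:R / mesh n * row_norm D nb x @[n --> U]
    --> (t - s) * row_norm D nb x.
  apply: cvgM (cvg_cst _); exact: cvg_trans (cvg_app _ U_oo) (@steps_cvg s t s0 st).
apply: (ler_cvg_to c1 c2); apply: nearW => n.
rewrite /approx -{1}(subnKC (steps_mono n st)).
by apply: (euler_lip D_offdiag nb_uniq nb_supp D_row0) => //; exact: mesh_dom.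
Qed.

Lemma euler_lim_taylor s t x y : 0 <= s -> s <= t ->
  `|euler_lim t x y - euler_lim s x y - (t - s) * gen s x y| <=
    (t - s) ^+ 2 * row_norm2 D nb x.
Proof.
move=> s0 st.
have c0 : (steps n t - steps n s)%:R / mesh n @[n --> U] --> t - s.
  exact: cvg_trans (cvg_app _ U_oo) (@steps_cvg s t s0 st).
have c1 : `|approx n t x y - approx n s x y - (steps n t - steps n s)%:R / mesh n
      * truncated_gen D (window n) (approx n s) x y| @[n --> U] -->
    `|euler_lim t x y - euler_lim s x y - (t - s) * gen s x y|.
  apply: cvg_norm; apply: cvgB; first by apply: cvgB; exact: approx_cvg.
  exact: cvgM.
have c2 : ((steps n t - steps n s)%:R / mesh n) ^+ 2 * row_norm2 D nb x
    @[n --> U] --> (t - s) ^+ 2 * row_norm2 D nb x.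
  by apply: cvgM (cvg_cst _); exact: cvgM.
apply: (ler_cvg_to c1 c2); apply: nearW => n.
rewrite /approx -{1}(subnKC (steps_mono n st)).
by apply: (euler_taylor D_offdiag nb_uniq nb_supp D_row0) => //; exact: mesh_dom.
Qed.

End euler_limit.

(** * Reversibility of the minimal solution *)

(** A second-order estimate from the left endpoint only is enough: the Lipschitz
    bound on [g] moves the base point to the right endpoint. *)
Lemma taylor_derivative (R : realType) (q g : R -> R) (C L : R) :
  0 <= C -> 0 <= L ->
  (forall s t, 0 <= s -> s <= t ->
    `|q t - q s - (t - s) * g s| <= (t - s) ^+ 2 * C) ->
  (forall s t, 0 <= s -> s <= t -> `|g t - g s| <= (t - s) * L) ->
  forall t, 0 <= t ->
  (fun s => (q s - q t) / (s - t)) @ within [set s : R | 0 <= s] t^' --> g t.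
Proof.
move=> C0 L0 qg gL t t0; apply/cvgrPdist_le => e e0.
have CL : 0 < C + L + 1 by lra.
have : \forall s \near t, `|t - s| < e / (C + L + 1).
  by apply: nbhsx_ballx; rewrite divr_gt0.
rewrite /dnbhs !near_withinE; apply: filterS => s st sNt s0.
have {}st : `|s - t| * (C + L) <= e.
  rewrite distrC; move: st; rewrite ltr_pdivlMr// => /ltW; apply: le_trans.
  by rewrite ler_wpM2l// lerDl.
apply: le_trans st; have st_neq0 : s - t != 0 by rewrite subr_eq0.
rewrite -[X in X <= _]/(`|_|) (_ : g t - _ =
    ((s - t) * g t - (q s - q t)) / (s - t)); last by field.
rewrite normrM normfV ler_pdivrMr ?normr_gt0// mulrAC -expr2 real_normK ?num_real//.
have [ts|/ltW ts] := leP t s.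
  rewrite distrC; apply: le_trans (qg _ _ t0 ts) _.
  by rewrite ler_wpM2l ?sqr_ge0// lerDl.
rewrite (_ : _ - _ = (q t - q s - (t - s) * g s) - (t - s) * (g t - g s)); last ring.
apply: (le_trans (ler_normB _ _)); rewrite [leRHS]mulrDr lerD//.
  by rewrite -sqrrN opprB; exact: qg.
rewrite normrM ger0_norm ?subr_ge0// -sqrrN opprB expr2 -mulrA ler_wpM2l ?subr_ge0//.
exact: gL.
Qed.

Section reversible_chain.
Context (R : realType) (T : countType) (D : T -> T -> R).
Hypothesis D_offdiag : forall x y, x != y -> 0 <= D x y.
Hypothesis D_fin : forall x, finite_set [set y | D x y != 0].
Hypothesis D_row0 : forall x, \sum_(y \in [set: T]) D x y = 0.

Let nb x : seq T := enum_fset (fset_set [set y | D x y != 0]).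

Let nb_uniq x : uniq (nb x). Proof. exact: fset_uniq. Qed.

Let nb_supp x y : D x y != 0 -> y \in nb x.
Proof. by move=> xy; rewrite /nb in_fset_set//; exact: mem_set. Qed.

Let row_sumE (f : T -> R) x :
  \sum_(z \in [set: T]) D x z * f z = \sum_(z <- nb x) D x z * f z.
Proof.
apply: fsbig_support => // z; rewrite mulf_eq0 negb_or => /andP[+ _].
exact: nb_supp.
Qed.

Let nb_row0 x : \sum_(y <- nb x) D x y = 0.
Proof. by rewrite -[RHS](D_row0 x) (fsbig_support (nb_uniq x))//; exact: nb_supp. Qed.

Let row_norm_nneg x : 0 <= row_norm D nb x.
Proof. exact: row_norm_ge0. Qed.

Let row_norm2_nneg x : 0 <= row_norm2 D nb x.
Proof. by apply: sumr_ge0 => z _; rewrite mulr_ge0. Qed.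

Lemma euler_lim_solution U : UltraFilter U -> \oo `<=` U ->
  nonneg_solution D (euler_lim D U).
Proof.
move=> UU Uoo; split=> [t x y _|x y|t x y t0].
- exact: (euler_lim_ge0 D_offdiag nb_uniq nb_supp nb_row0).
- exact: euler_lim0.
rewrite row_sumE.
apply: (@taylor_derivative R (fun t => euler_lim D U t x y)
  (fun t => \sum_(z <- nb x) D x z * euler_lim D U t z y)
  (row_norm2 D nb x) (row_norm2 D nb x)) => // [r s r0 rs|r s r0 rs].
  exact: (euler_lim_taylor D_offdiag nb_uniq nb_supp nb_row0).
rewrite -sumrB; apply: (le_trans (ler_norm_sum _ _ _)).
rewrite /row_norm2 mulr_sumr; apply: ler_sum => z _.
rewrite -mulrBr normrM mulrCA ler_wpM2l//.
exact: (euler_lim_lip D_offdiag nb_uniq nb_supp nb_row0).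
Qed.

(** The limit of the Euler kernels is one nonnegative solution, so it dominates
    the minimal solution [p]; it is substochastic while [p] is stochastic, so
    both agree.  The limit is symmetric with respect to [pi], being a limit of
    symmetric kernels. *)
Theorem minimal_solution_reversible (p : R -> T -> T -> R) (pi : T -> R) :
  minimal_nonneg_solution D p ->
  (forall t x, 0 <= t -> \esum_(y in [set: T]) (p t x y)%:E = 1%:E) ->
  (forall x y, pi x * D x y = pi y * D y x) ->
  forall t x y, 0 <= t -> pi x * p t x y = pi y * p t y x.
Proof.
move=> [[p0 _ _] pmin] p1 piD t x y t0.
have [U [UU Uoo]] := ultraFilterLemma (@eventually_filter).
have qsol := euler_lim_solution UU Uoo.
have pE z w : p t z w = euler_lim D U t z w.
  apply: (@esum_le_eq _ _ (p t z) (euler_lim D U t z)); rewrite ?p1 ?ltry//.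
  - by move=> v; exact: p0.
  - by move=> v; exact: pmin.
  - apply: esum_fin_le => S.
    exact: (euler_lim_sum_le1 D_offdiag nb_uniq nb_supp nb_row0).
rewrite !pE; exact: (euler_lim_sym D_offdiag nb_uniq nb_supp nb_row0).
Qed.

End reversible_chain.

(** * Invariant laws of an irreducible transition function *)

Section invariant_masses.
Context (R : realType) (T : choiceType) (D : T -> T -> R)
  (p : R -> T -> T -> R).
Hypothesis p_sol : nonneg_solution D p.
Hypothesis p_sum1 :
  forall t x, 0 <= t -> \esum_(y in [set: T]) (p t x y)%:E = 1%:E.
Hypothesis D_conn : forall x y : T, exists2 s : seq T,
  path (fun a b => 0 < D a b) x s & y = last x s.

Definition invariant_mass (h : T -> R) : Prop := forall t y, 0 <= t ->
  \esum_(x in [set: T]) (h x * p t x y)%:E = (h y)%:E.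

(** At time 0 the derivative of p_t(x, y) is D(x, y) > 0 and p_0(x, y) = 0. *)
Lemma solution_pos x y : x != y -> 0 < D x y -> exists2 t, 0 <= t & 0 < p t x y.
Proof.
move=> xy Dxy; have [p0 p_0 p'] := p_sol.
have := p' 0 x y (lexx 0).
have -> : \sum_(k \in [set: T]) D x k * p 0 k y = D x y.
  rewrite (@fsbig_support _ _ [:: y])//= ?big_seq1 ?p_0 ?eqxx ?mulr1// => z.
  by rewrite p_0 inE; case: (z == y) => //; rewrite mulr0 eqxx.
move=> /cvgr_gt/(_ _ Dxy); rewrite /dnbhs !near_withinE => /nbhs_ballP[e /= e0].
move=> ball_gt0; have e20 : 0 < e / 2 by rewrite divr_gt0.
exists (e / 2); first exact: ltW.
have := ball_gt0 (e / 2).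
rewrite /ball/= sub0r normrN (gtr0_norm e20) p_0 (negbTE xy) !subr0 => quot_gt0.
rewrite -(pmulr_lgt0 _ (_ : 0 < (e / 2)^-1)) ?invr_gt0//.
by apply: quot_gt0; rewrite ?gt_eqF// ?ltW// ltr_pdivrMr// ltr_pMr// ltr1n.
Qed.

(** Positivity spreads along the edges of the rate graph.  Since [h] is invariant
    at all times, each edge may use its own time. *)
Lemma invariant_mass_pos h x y : (forall x, 0 <= h x) -> invariant_mass h ->
  0 < h x -> 0 < h y.
Proof.
move=> h0 hinv; have [s + ->] := D_conn x y; have [p0 _ _] := p_sol.
elim: s x => //= z s IH x /andP[xz zs] hx; apply: IH => //.
have [<-//|xNz] := eqVneq x z.
have [t t0 pt] := solution_pos xNz xz.
rewrite -lte_fin -(hinv t z t0).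
apply: (@lt_le_trans _ _ (h x * p t x z)%:E); first by rewrite lte_fin mulr_gt0.
rewrite -(@esum_set1 R T x (fun x => (h x * p t x z)%:E)); last first.
  by rewrite lee_fin mulr_ge0// p0.
rewrite [leRHS](esumID [set x]); last by move=> w _; rewrite lee_fin mulr_ge0// p0.
by rewrite setTI leeDl// esum_ge0// => w _; rewrite lee_fin mulr_ge0// p0.
Qed.

Lemma esum_eq1_le_eq (a b : T -> R) : (forall y, 0 <= a y) -> (forall y, a y <= b y) ->
  \esum_(y in [set: T]) (b y)%:E = 1%:E -> \esum_(y in [set: T]) (a y)%:E = 1%:E ->
  forall y, a y = b y.
Proof. by move=> a0 ab b1 a1; apply: esum_le_eq => //; rewrite a1 ?b1 ?ltry. Qed.

(** The minimum is pushed below itself by a stochastic kernel, which preserves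
    its total mass. *)
Lemma min_invariant_mass (mu nu : T -> R) :
  (forall x, 0 <= mu x) -> (forall x, 0 <= nu x) ->
  \esum_(x in [set: T]) (mu x)%:E = 1%:E ->
  invariant_mass mu -> invariant_mass nu ->
  invariant_mass (fun x => Num.min (mu x) (nu x)).
Proof.
move=> mu0 nu0 mu1 mui nui t y t0; have [p0 _ _] := p_sol.
set m := fun x => Num.min (mu x) (nu x).
have m0 x : 0 <= m x by rewrite /m le_min mu0 nu0.
pose mp y := \esum_(x in [set: T]) (m x * p t x y)%:E.
have mp_le z : (mp z <= (m z)%:E)%E.
  rewrite /m EFin_min le_min; apply/andP; split.
    rewrite -(mui t z t0); apply: le_esum => x _; rewrite lee_fin ler_wpM2r ?p0//.
    by rewrite ge_min lexx.
  rewrite -(nui t z t0); apply: le_esum => x _; rewrite lee_fin ler_wpM2r ?p0//.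
  by rewrite ge_min lexx orbT.
have mp0 z : (0 <= mp z)%E.
  by apply: esum_ge0 => x _; rewrite lee_fin mulr_ge0// p0.
have mp_fin z : mp z \is a fin_num.
  by rewrite ge0_fin_numE// (le_lt_trans (mp_le z))// ltry.
rewrite -/(mp y) -(fineK (mp_fin y)); congr _%:E.
apply: (@esum_le_eq _ _ (fine \o mp) m) => /= [z|z||].
- by rewrite fine_ge0.
- by rewrite -lee_fin fineK.
- under [leRHS]eq_esum do rewrite fineK//.
  rewrite /mp esum_exchange; last by move=> i j; rewrite lee_fin mulr_ge0// p0.
  apply: le_esum => x _.
  under eq_esum do rewrite EFinM.
  by rewrite ge0_esumZl// ?p_sum1 ?mule1// => z; rewrite lee_fin p0.
- under eq_esum do rewrite fineK//.
  apply: (@le_lt_trans _ _ 1%:E); last exact: ltry.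
  rewrite -mu1; apply: le_esum => x _; apply: (le_trans (mp_le x)).
  by rewrite lee_fin ge_min lexx.
Qed.

(** With m = min(mu, nu), the invariant mass mu - m is either 0 or positive
    everywhere.  In the first case mu <= nu; in the second nu = m <= mu.  Equal
    total masses give mu = nu in both cases. *)
Theorem invariant_mass_unique (mu nu : T -> R) :
  (forall x, 0 <= mu x) -> (forall x, 0 <= nu x) ->
  \esum_(x in [set: T]) (mu x)%:E = 1%:E ->
  \esum_(x in [set: T]) (nu x)%:E = 1%:E ->
  invariant_mass mu -> invariant_mass nu -> forall x, mu x = nu x.
Proof.
move=> mu0 nu0 mu1 nu1 mui nui; have [p0 _ _] := p_sol.
set m := fun x => Num.min (mu x) (nu x).
have m0 x : 0 <= m x by rewrite /m le_min mu0 nu0.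
have mi : invariant_mass m by exact: min_invariant_mass.
have mmu x : m x <= mu x by rewrite ge_min lexx.
have hi : invariant_mass (fun x => mu x - m x).
  move=> t y t0; have := mui t y t0.
  have -> : \esum_(x in [set: T]) (mu x * p t x y)%:E =
      (\esum_(x in [set: T]) ((mu x - m x) * p t x y)%:E + (m y)%:E)%E.
    rewrite -(mi t y t0) -esumD.
    - by apply: eq_esum => x _; rewrite -EFinD -mulrDl subrK.
    - by move=> x _; rewrite lee_fin mulr_ge0 ?subr_ge0// p0.
    - by move=> x _; rewrite lee_fin mulr_ge0// p0.
  by move=> sum_eq; rewrite EFinB -sum_eq addeK.
have [[x0 hx0]|h0] := pselect (exists x0, 0 < mu x0 - m x0).
  have mnu x : m x = nu x.
    have : 0 < mu x - m x.
      by apply: (invariant_mass_pos _ _ hi hx0) => w; rewrite subr_ge0.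
    by rewrite subr_gt0 /m; case: (ltP (mu x) (nu x)); rewrite ?ltxx.
  move=> x; rewrite -mnu; apply/esym.
  apply: (@esum_eq1_le_eq m mu) => //.
  by rewrite -nu1; apply: eq_esum => w _; rewrite mnu.
have hm x : mu x = m x.
  apply/eqP; rewrite eq_le mmu andbT leNgt -subr_gt0; apply/negP => ?.
  by apply: h0; exists x.
apply: esum_eq1_le_eq => // x; rewrite hm.
by rewrite ge_min lexx orbT.
Qed.

End invariant_masses.

(** Sum the reversibility relation over the starting point. *)
Lemma reversible_invariant_mass (R : realType) (T : choiceType)
    (p : R -> T -> T -> R) (pi : T -> R) :
  (forall x, 0 <= pi x) -> (forall t x y, 0 <= t -> 0 <= p t x y) ->
  (forall t x, 0 <= t -> \esum_(y in [set: T]) (p t x y)%:E = 1%:E) ->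
  (forall t x y, 0 <= t -> pi x * p t x y = pi y * p t y x) ->
  invariant_mass p pi.
Proof.
move=> pi0 p0 p1 sym t y t0; rewrite -[RHS]mule1 -(p1 t y t0) -ge0_esumZl//.
  by apply: eq_esum => x _; rewrite sym// EFinM.
by move=> x; rewrite lee_fin p0.
Qed.

(** * The functional equation of the Gamma function *)

Section gamma.
Context (R : realType).
Implicit Types s : R[i].

Definition gauss s (n : nat) : R[i] :=
  n`!%:R * cexp (s * (ln n%:R)%:C) / \prod_(k < n.+1) (s + k%:R).

Lemma cexpDln s n : (0 < n)%N ->
  cexp ((s + 1) * (ln n%:R)%:C) = cexp (s * (ln n%:R)%:C) * n%:R.
Proof.
move=> n0; case: s => a b; rewrite /cexp /= !mulr0 !subr0 !add0r.
rewrite mulrDl mul1r expRD lnK ?posrE ?ltr0n// rmorphM/= rmorph_nat.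
by rewrite addr0 mulrAC.
Qed.

(** Shifting [s] multiplies the Gauss product by [s] and by a factor n / (s+n+1),
    written here as the inverse of 1 + (s + 1) / n. *)
Lemma gauss_shift s n : (forall k : nat, s + k%:R != 0) -> (0 < n)%N ->
  gauss (s + 1) n = s * (gauss s n * (1 + (s + 1) * n%:R^-1)^-1).
Proof.
move=> s_neq n0; rewrite /gauss cexpDln//.
have prodE : s * \prod_(k < n.+1) (s + 1 + k%:R) =
    \prod_(k < n.+1) (s + k%:R) * (s + n.+1%:R).
  rewrite -(big_mkord xpredT (fun k => s + k%:R)) -big_nat_recr//= big_nat_recl//=.
  rewrite addr0 big_mkord; congr (_ * _); apply: eq_bigr => k _.
  by rewrite -natr1; ring.
have P0 : \prod_(k < n.+1) (s + k%:R) != 0 by apply/prodf_neq0 => k _.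
have s0 : s != 0 by have := s_neq 0%N; rewrite addr0.
have Q0 : \prod_(k < n.+1) (s + 1 + k%:R) != 0.
  apply/prodf_neq0 => k _; rewrite -addrA nat1r; exact: s_neq.
have nn : n%:R != 0 :> R[i] by rewrite pnatr_eq0 -lt0n.
have sn := s_neq n.+1.
have -> : \prod_(k < n.+1) (s + k%:R) =
   s * \prod_(k < n.+1) (s + 1 + k%:R) / (s + n.+1%:R).
  by rewrite prodE mulfK.
move: sn; rewrite -natr1 => sn.
have sn' : n%:R + (s + 1) != 0 by rewrite addrCA.
by field; rewrite Q0 s0 nn sn'.
Qed.

Lemma invn_cvg0 : (n%:R^-1 : R[i]^o) @[n --> \oo] --> (0 : R[i]^o).
Proof.
apply/cvgr0Pnorm_le => e; case: e => a b; rewrite ltcE/= => /andP[/eqP -> a0].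
have := nbhs_infty_gtr a^-1; apply: filterS => n an.
have n0 : 0 < n%:R :> R by apply: lt_trans an; rewrite invr_gt0.
rewrite ger0_norm ?invr_ge0 ?ler0n// -(rmorph_nat (real_complex R)) -fmorphV/=.
by rewrite lecR invf_ple ?posrE// ltW.
Qed.

(** Pass to the limit in the previous identity.  The products at [s] and at
    [s + 1] converge or diverge simultaneously; if they diverge, both limits
    have the conventional value 0 and the equation reads 0 = s * 0. *)
Lemma Gamma_shift s : (forall k : nat, s + k%:R != 0) ->
  Gamma (s + 1) = s * Gamma s.
Proof.
move=> s_neq; have s0 : s != 0 by have := s_neq 0%N; rewrite addr0.
have ratio_cvg : (1 + (s + 1) * n%:R^-1 : R[i]^o) @[n --> \oo] --> (1 : R[i]^o).
  rewrite -[X in _ --> X]addr0 -[X in _ --> _ + X](mulr0 (s + 1)).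
  by apply: cvgD; [exact: cvg_cst|apply: cvgM; [exact: cvg_cst|exact: invn_cvg0]].
have ratioV_cvg : ((1 + (s + 1) * n%:R^-1)^-1 : R[i]^o) @[n --> \oo] --> (1 : R[i]^o).
  by rewrite -[X in _ --> X]invr1; apply: cvgV => //; exact: oner_neq0.
have shiftE : \forall n \near \oo,
    gauss (s + 1) n = s * (gauss s n * (1 + (s + 1) * n%:R^-1)^-1).
  by exists 1%N => // n /= n0; exact: gauss_shift.
have ratio_neq0 : \forall n \near \oo, 1 + (s + 1) * n%:R^-1 != 0 :> R[i].
  exists 1%N => // n /= n0; have nn : n%:R != 0 :> R[i] by rewrite pnatr_eq0 -lt0n.
  rewrite (_ : _ + _ = (s + n.+1%:R) / n%:R); last by rewrite -natr1; field.
  by rewrite mulf_neq0// invr_neq0.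
have [/cvg_ex[l gl]|dv] := pselect (cvgn (gauss s : nat -> R[i]^o)).
  have gl' : (gauss (s + 1) n : R[i]^o) @[n --> \oo] --> (s * l : R[i]^o).
    apply: cvg_trans (near_eq_cvg _) _; first by apply: filterS shiftE => n ->.
    apply: cvgM; first exact: cvg_cst.
    by rewrite -[X in _ --> X]mulr1; apply: cvgM.
  by rewrite /Gamma (cvg_lim _ gl)// (cvg_lim _ gl').
have dv' : ~ cvgn (gauss (s + 1) : nat -> R[i]^o).
  move=> /cvg_ex[l gl]; apply: dv; apply/cvg_ex; exists (s^-1 * (l * 1)).
  have gaussE : \forall n \near \oo,
      s^-1 * (gauss (s + 1) n * (1 + (s + 1) * n%:R^-1)) = gauss s n.
    move: shiftE ratio_neq0; apply: filterS2 => n -> r0.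
    by rewrite -mulrA mulfVK// mulKf.
  apply: cvg_trans (near_eq_cvg gaussE) _.
  by apply: cvgM; [exact: cvg_cst|apply: cvgM; [exact: gl|exact: ratio_cvg]].
by rewrite /Gamma (dvgP dv) (dvgP dv') mulr0.
Qed.

End gamma.

(** * Signatures and their dimensions *)

Section signatures.
Context (N : nat).
Implicit Types (l m : GT N) (i j k : 'I_N).

Lemma sig_anti l i j : (i <= j)%N -> l j <= l i.
Proof.
case: l => f /= /'forall_'forall_implyP H ij; exact: H.
Qed.

Lemma lcoord_anti l i j : (i < j)%N -> lcoord l j < lcoord l i.
Proof. by move=> ij; have := sig_anti l (ltnW ij); rewrite /lcoord; lia. Qed.

Lemma lcoord_inj l i j : i != j -> lcoord l i != lcoord l j.
Proof.
rewrite neq_ltn => /orP[] /(lcoord_anti l) h; first by rewrite gt_eqF.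
by rewrite lt_eqF.
Qed.

(** [m] is obtained from [l] by adding a box in row [i]: these are the edges of
    the jump graph. *)
Definition covers l m i := sigval m = sigval l + std_vec i.

Lemma coversE l m i : covers l m i -> forall j, m j = l j + (j == i)%:R.
Proof. by move=> lm j; rewrite lm !ffunE. Qed.

Lemma lcoord_covers l m i : covers l m i ->
  forall j, lcoord m j = lcoord l j + (j == i)%:R.
Proof. by move=> lm j; rewrite /lcoord (coversE lm); ring. Qed.

(** The coordinates of both [l] and [m] are strictly decreasing, so a gap keeps its
    sign, and does not vanish, when its first end moves by one. *)
Lemma lcoord_covers_gap l m i j : covers l m i -> j != i ->
  0 < (lcoord l i + 1 - lcoord l j) * (lcoord l i - lcoord l j).
Proof.
move=> lm ji; have /(_ j) := lcoord_covers lm; have /(_ i) := lcoord_covers lm.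
rewrite eqxx (negbTE ji) addr0 => mi mj.
move: ji; rewrite neq_ltn => /orP[] ji.
  by have := lcoord_anti l ji; have := lcoord_anti m ji; rewrite mi mj; nia.
by have := lcoord_anti l ji; have := lcoord_anti m ji; rewrite mi mj; nia.
Qed.

End signatures.

Section dimension.
Context (R : realType) (N : nat).
Implicit Types (l m : GT N) (i j k : 'I_N).

Definition gap l i j : R := (lcoord l i - lcoord l j)%:~R.

Lemma gap_anti l i j : gap l i j = - gap l j i.
Proof. by rewrite /gap -mulrNz; congr _%:~R; ring. Qed.

Definition gaps l i : R := \prod_(j < N | j != i) gap l i j.

Definition gaps_up l i : R := \prod_(j < N | j != i) (gap l i j + 1).

Lemma prod_lt_exchange (F : 'I_N -> 'I_N -> R) :
  \prod_(i < N) \prod_(j < N | (j < i)%N) F i j =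
  \prod_(i < N) \prod_(j < N | (i < j)%N) F j i.
Proof. by rewrite (exchange_big_dep xpredT). Qed.

(** Squaring the Vandermonde product makes it, up to a constant sign, a product
    over ordered pairs, which is a product of the local quantities [gaps]. *)
Lemma Dim_sq : exists c : R, forall l, Dim R l ^+ 2 = c * \prod_i gaps l i.
Proof.
pose e : R := \prod_(i < N) \prod_(j < N | (i < j)%N) (- 1).
pose f : R := \prod_(1 <= i < N) i`!%:R.
exists (e / f ^+ 2) => l; rewrite /Dim -/f expr_div_n.
set V := \prod_(i < N) _.
suff -> : \prod_i gaps l i = e * V ^+ 2.
  have ee : e * e = 1.
    rewrite /e -big_split/= big1// => i _; rewrite -big_split/= big1// => j _.
    by rewrite mulrNN mulr1.
  by rewrite mulrA [e / _ * e]mulrAC ee mul1r mulrC.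
have VE : V = \prod_(i < N) \prod_(j < N | (i < j)%N) gap l i j.
  apply: eq_bigr => i _; apply: eq_bigr => j _; rewrite /gap /lcoord.
  by congr _%:~R; lia.
transitivity ((\prod_(i < N) \prod_(j < N | (i < j)%N) gap l i j) *
  (\prod_(i < N) \prod_(j < N | (j < i)%N) gap l i j)).
  rewrite -big_split/=; apply: eq_bigr => i _.
  rewrite /gaps (bigID (fun j : 'I_N => (i < j)%N))/=; congr (_ * _).
    by apply: eq_bigl => j; rewrite -val_eqE/=; lia.
  by apply: eq_bigl => j; rewrite -val_eqE/=; lia.
rewrite prod_lt_exchange expr2 mulrA -VE mulrC; congr (_ * _).
rewrite /e VE -big_split/=; apply: eq_bigr => i _; rewrite -big_split/=.
by apply: eq_bigr => j _; rewrite mulN1r gap_anti.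
Qed.

Lemma gaps_neq0 l i : gaps l i != 0.
Proof.
apply/prodf_neq0 => j ji; rewrite intr_eq0 subr_eq0; apply: lcoord_inj.
by rewrite eq_sym.
Qed.

Lemma gap_covers l m i j k : covers l m i ->
  gap m j k = gap l j k + (j == i)%:R - (k == i)%:R.
Proof.
move=> lm; rewrite /gap !(lcoord_covers lm) !intrB !intrD.
by case: (j == i); case: (k == i); ring.
Qed.

Lemma gaps_covers l m i : covers l m i -> gaps m i = gaps_up l i.
Proof.
move=> lm; apply: eq_bigr => j ji; rewrite (gap_covers _ _ lm) eqxx (negbTE ji).
by rewrite subr0.
Qed.

(** Only the pairs involving [i] change, and each of them occurs twice. *)
Lemma prod_gaps_covers l m i : covers l m i ->
  (\prod_k gaps m k) * gaps l i ^+ 2 = (\prod_k gaps l k) * gaps m i ^+ 2.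
Proof.
move=> lm.
pose rest l' := \prod_(k | k != i) \prod_(j | (j != k) && (j != i)) gap l' k j.
have prodE l' : \prod_k gaps l' k =
    gaps l' i ^+ 2 * \prod_(k < N | k != i) (- 1) * rest l'.
  rewrite (bigD1 i)//= expr2 -!mulrA; congr (_ * _).
  rewrite mulrA -big_split/= -big_split/=; apply: eq_bigr => k ki.
  rewrite /gaps (bigD1 i) 1?eq_sym//=; congr (_ * _).
  by rewrite mulrN1 gap_anti.
have -> : \prod_k gaps m k = gaps m i ^+ 2 * \prod_(k < N | k != i) (- 1) * rest l.
  rewrite prodE; congr (_ * _); apply: eq_bigr => k ki.
  apply: eq_bigr => j /andP[_ ji]; rewrite (gap_covers _ _ lm).
  by rewrite (negbTE ki) (negbTE ji); ring.
rewrite prodE; ring.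
Qed.

Lemma Dim_sq_covers l m i : covers l m i ->
  Dim R m ^+ 2 * gaps l i ^+ 2 = Dim R l ^+ 2 * gaps m i ^+ 2.
Proof.
move=> lm; have [c cE] := Dim_sq.
by rewrite !cE -!mulrA prod_gaps_covers.
Qed.

End dimension.

(** * Detailed balance between the rates and the zw-measures *)

Lemma intrSB (R : realType) (a b : int) : (a + 1 - b)%:~R = (a - b)%:~R + 1 :> R.
Proof. by rewrite addrAC [LHS]intrD mulr1z. Qed.

Lemma invf_shift_factors (F : fieldType) (a a' b b' A A' B B' : F) :
  a != 0 -> a' != 0 -> b != 0 -> b' != 0 ->
  (A * A' * (b * B) * (b' * B'))^-1 * (b * b') =
  ((a * A) * (a' * A') * B * B')^-1 * (a * a').
Proof.
rewrite !invfM; move: A^-1 A'^-1 B^-1 B'^-1 => {}A {}A' {}B {}B' a0 a'0 b0 b'0.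
by field; rewrite a0 a'0 b0 b'0.
Qed.

Section rates.
Context (R : realType) (z z' w w' : R[i]).
Hypothesis hz : forall k : int, 0 < (z + k%:~R) * (z' + k%:~R).
Hypothesis hw : forall k : int, 0 < (w + k%:~R) * (w' + k%:~R).
Context (N : nat).
Implicit Types (l m : GT N) (i j k : 'I_N).

Definition up_coef l i : R[i] :=
  ((lcoord l i)%:~R - (z + N%:R - 1)) * ((lcoord l i)%:~R - (z' + N%:R - 1)).

Definition down_coef l i : R[i] :=
  ((lcoord l i)%:~R + w) * ((lcoord l i)%:~R + w').

Lemma up_coef_gt0 l i : 0 < up_coef l i.
Proof.
rewrite /up_coef; move: (lcoord l i) => L; have := hz (N%:Z - 1 - L).
by rewrite !intrB mulr1z -pmulrn; congr (_ < _); ring.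
Qed.

Lemma down_coef_gt0 l i : 0 < down_coef l i.
Proof.
by have := hw (lcoord l i); congr (_ < _); rewrite /down_coef; ring.
Qed.

Lemma gaps_quotient_gt0 l m i : covers l m i -> 0 < gaps R m i / gaps R l i.
Proof.
move=> lm; rewrite (gaps_covers _ lm) -prodf_div; apply: prodr_gt0 => j ji.
have gap2 : 0 < (gap R l i j + 1) * gap R l i j.
  move: (lcoord_covers_gap lm ji); rewrite /gap.
  move: (lcoord l i) (lcoord l j) => a b.
  by rewrite -(ltr0z R) intrM intrSB.
have g0 : gap R l i j != 0 by apply: contraTneq gap2 => ->; rewrite mulr0 ltxx.
rewrite (_ : _ / _ = (gap R l i j + 1) * gap R l i j / gap R l i j ^+ 2).
  by rewrite divr_gt0// exprn_even_gt0.
by rewrite expr2 -mulf_div divff ?mulr1.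
Qed.

Lemma rate_upE l m i : covers l m i ->
  rate_up z z' l i = complex.Re (up_coef l i) * (gaps R m i / gaps R l i).
Proof.
move=> lm; rewrite /rate_up (gaps_covers _ lm) -prodf_div; congr (_ * _).
by apply: eq_bigr => j ji; rewrite intrSB.
Qed.

Lemma rate_downE l m i : covers l m i ->
  rate_down w w' m i = complex.Re (down_coef m i) * (gaps R l i / gaps R m i).
Proof.
move=> lm; rewrite /rate_down -prodf_div; congr (_ * _).
apply: eq_bigr => j ji; rewrite -!/(gap _ _ _ _).
rewrite (gap_covers R i j lm) eqxx (negbTE ji) subr0 /gap.
rewrite !(lcoord_covers lm) eqxx (negbTE ji) addr0.
by rewrite addrK.
Qed.

Lemma rate_up_gt0 l m i : covers l m i -> 0 < rate_up z z' l i.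
Proof.
move=> lm; rewrite (rate_upE lm) mulr_gt0 ?(gaps_quotient_gt0 lm)//.
by have := up_coef_gt0 l i; case: up_coef => a b; rewrite ltcE/= => /andP[].
Qed.

Lemma rate_down_gt0 l m i : covers l m i -> 0 < rate_down w w' m i.
Proof.
move=> lm; rewrite (rate_downE lm) mulr_gt0//; last first.
  by rewrite -invf_div invr_gt0 gaps_quotient_gt0.
by have := down_coef_gt0 m i; case: down_coef => a b; rewrite ltcE/= => /andP[].
Qed.

Definition gamma_factor l i : R[i] :=
  (Gamma (z - (l i)%:~R + i.+1%:R) * Gamma (z' - (l i)%:~R + i.+1%:R) *
   Gamma (w + N%:R + 1 + (l i)%:~R - i.+1%:R) *
   Gamma (w' + N%:R + 1 + (l i)%:~R - i.+1%:R))^-1.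

Lemma int_shift_neq0 (a b : R[i]) : (forall k : int, 0 < (a + k%:~R) * (b + k%:~R)) ->
  (forall k : int, a + k%:~R != 0) /\ (forall k : int, b + k%:~R != 0).
Proof.
by move=> ab; split=> k; apply: contraTneq (ab k) => ->; rewrite ?mul0r ?mulr0 ltxx.
Qed.

Lemma Gamma_shift_int (a : R[i]) (k : int) : (forall k : int, a + k%:~R != 0) ->
  Gamma (a + (k + 1)%:~R) = (a + k%:~R) * Gamma (a + k%:~R).
Proof.
move=> a_neq; rewrite intrD addrA rmorph1; apply: Gamma_shift => n.
by have := a_neq (k + n%:Z); rewrite intrD addrA -pmulrn.
Qed.

(** The functional equation of the Gamma function, applied to each of its four
    occurrences, produces the two quadratic factors of the rates. *)
Lemma gamma_factor_covers l m i : covers l m i ->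
  gamma_factor m i * down_coef m i = gamma_factor l i * up_coef l i.
Proof.
move=> lm; have [z_neq z'_neq] := int_shift_neq0 hz; have [w_neq w'_neq] := int_shift_neq0 hw.
have mi : m i = l i + 1 by rewrite (coversE lm) eqxx.
pose kz : int := i.+1%:Z - l i - 1.
pose kw : int := lcoord l i + 1.
have up_arg (a : R[i]) : a - (l i)%:~R + i.+1%:R = a + (kz + 1)%:~R.
  by rewrite /kz; ring.
have up_arg' (a : R[i]) : a - (m i)%:~R + i.+1%:R = a + kz%:~R.
  by rewrite /kz mi; ring.
have down_arg (a : R[i]) : a + N%:R + 1 + (l i)%:~R - i.+1%:R = a + kw%:~R.
  by rewrite /kw /lcoord; ring.
have down_arg' (a : R[i]) : a + N%:R + 1 + (m i)%:~R - i.+1%:R = a + (kw + 1)%:~R.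
  by rewrite /kw /lcoord mi; ring.
have down_coefE : down_coef m i = (w + kw%:~R) * (w' + kw%:~R).
  by rewrite /down_coef (lcoord_covers lm) eqxx (_ : lcoord l i + true%:R = kw)//; ring.
have up_coefE : up_coef l i = (z + kz%:~R) * (z' + kz%:~R).
  by rewrite /up_coef /kz /lcoord; ring.
rewrite /gamma_factor !up_arg !up_arg' !down_arg !down_arg' down_coefE up_coefE.
rewrite !Gamma_shift_int//; exact: invf_shift_factors.
Qed.

Lemma zw_weight_covers l m i : covers l m i ->
  zw_weight z z' w w' m * (down_coef m i * ((gaps R l i / gaps R m i))%:C) =
  zw_weight z z' w w' l * (up_coef l i * ((gaps R m i / gaps R l i))%:C).
Proof.
move=> lm; rewrite /zw_weight -/(gamma_factor _ _).
rewrite !(bigD1 (P := predT) i)//= -!/(gamma_factor _ _).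
have -> : \prod_(j | j != i) gamma_factor m j = \prod_(j | j != i) gamma_factor l j.
  by apply: eq_bigr => j ji; rewrite /gamma_factor (coversE lm) (negbTE ji) addr0.
have gl := gaps_neq0 R l i; have gm := gaps_neq0 R m i.
have DD : Dim R m ^+ 2 * (gaps R l i / gaps R m i) =
    Dim R l ^+ 2 * (gaps R m i / gaps R l i).
  apply: (mulIf (_ : gaps R l i * gaps R m i != 0)); first exact: mulf_neq0.
  transitivity (Dim R m ^+ 2 * gaps R l i ^+ 2); first by field.
  by rewrite (Dim_sq_covers _ lm); field; rewrite gl.
set P := \prod_(j | _) _.
transitivity ((Dim R m ^+ 2 * (gaps R l i / gaps R m i))%:C *
  (gamma_factor m i * down_coef m i) * P).
  by rewrite [in RHS]rmorphM; ring.
by rewrite DD (gamma_factor_covers lm) rmorphM/=; ring.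
Qed.

Lemma Re_mulC (x : R[i]) (r : R) : complex.Re (x * r%:C) = complex.Re x * r.
Proof. by case: x => a b /=; rewrite mulr0 subr0. Qed.

Lemma gt0_ReC (x : R[i]) : 0 < x -> x = (complex.Re x)%:C.
Proof. by case: x => a b; rewrite ltcE/= => /andP[/eqP -> _]. Qed.

(** Detailed balance along an edge: the quadratic factors of the rates are
    accounted for by the Gamma factors, and the remaining products of gaps by
    the squared dimension. *)
Lemma zw_mass_covers l m i : covers l m i ->
  zw_mass z z' w w' m * rate_down w w' m i =
  zw_mass z z' w w' l * rate_up z z' l i.
Proof.
move=> lm; rewrite /zw_mass -!mulrA; congr (_ * _).
have ReM (x : R[i]) (r : R) : 0 < x -> (complex.Re x * r)%:C = x * r%:C.
  by move=> x0; rewrite rmorphM/= -gt0_ReC.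
rewrite (rate_downE lm) (rate_upE lm) -[LHS]Re_mulC -[RHS]Re_mulC.
rewrite (ReM _ _ (down_coef_gt0 m i)) (ReM _ _ (up_coef_gt0 l i)).
by rewrite (zw_weight_covers lm).
Qed.

Lemma zw_mass_reversible l m :
  zw_mass z z' w w' l * rate z z' w w' l m = zw_mass z z' w w' m * rate z z' w w' m l.
Proof.
rewrite /rate !mulr_sumr; apply: eq_bigr => i _; rewrite !mulrDr [RHS]addrC.
have up_down (a b : GT N) : zw_mass z z' w w' a *
      (if sigval b == sigval a + std_vec i then rate_up z z' a i else 0) =
    zw_mass z z' w w' b *
      (if sigval a == sigval b - std_vec i then rate_down w w' b i else 0).
  rewrite [sigval a == _]eq_sym subr_eq; case: eqP => [ab|]; rewrite ?mulr0//.
  by rewrite (zw_mass_covers ab).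
by congr (_ + _); rewrite up_down.
Qed.

Lemma rate_up_term_ge0 l m i :
  0 <= (if sigval m == sigval l + std_vec i then rate_up z z' l i else 0).
Proof. by case: eqP => // lm; exact/ltW/(rate_up_gt0 lm). Qed.

Lemma rate_down_term_ge0 l m i :
  0 <= (if sigval m == sigval l - std_vec i then rate_down w w' l i else 0).
Proof.
by rewrite eq_sym subr_eq; case: eqP => // ml; exact/ltW/(rate_down_gt0 ml).
Qed.

Lemma rate_ge0 l m : 0 <= rate z z' w w' l m.
Proof.
by apply: sumr_ge0 => i _; rewrite addr_ge0 ?rate_up_term_ge0 ?rate_down_term_ge0.
Qed.

Lemma rate_covers_gt0 l m i : covers l m i ->
  0 < rate z z' w w' l m /\ 0 < rate z z' w w' m l.
Proof.
have others (a b : GT N) : 0 <= \sum_(j < N | j != i)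
    ((if sigval b == sigval a + std_vec j then rate_up z z' a j else 0) +
     (if sigval b == sigval a - std_vec j then rate_down w w' a j else 0)).
  by apply: sumr_ge0 => j _; rewrite addr_ge0 ?rate_up_term_ge0 ?rate_down_term_ge0.
move=> lm; rewrite /rate !(bigD1 (P := predT) i)//=; split; apply: ltr_wpDr => //.
  apply: ltr_wpDr; first exact: rate_down_term_ge0.
  by rewrite ifT; [exact: (rate_up_gt0 lm)|apply/eqP].
apply: ltr_wpDl; first exact: rate_up_term_ge0.
rewrite ifT; first exact: (rate_down_gt0 lm).
by rewrite eq_sym subr_eq; apply/eqP.
Qed.

Lemma covers_neq l m i : covers l m i -> l != m.
Proof.
by move=> lm; apply/eqP => E; have := coversE lm i; rewrite E eqxx; lia.
Qed.

Lemma rate_matrix_offdiag_ge0 l m : l != m -> 0 <= rate_matrix z z' w w' l m.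
Proof. by rewrite /rate_matrix eq_sym => /negbTE ->; exact: rate_ge0. Qed.

Lemma rate_matrix_covers_gt0 l m i : covers l m i ->
  0 < rate_matrix z z' w w' l m /\ 0 < rate_matrix z z' w w' m l.
Proof.
move=> lm; have := covers_neq lm => lNm.
rewrite /rate_matrix eq_sym (negbTE lNm); exact: rate_covers_gt0 lm.
Qed.

Lemma rate_matrix_reversible l m :
  zw_mass z z' w w' l * rate_matrix z z' w w' l m =
  zw_mass z z' w w' m * rate_matrix z z' w w' m l.
Proof.
rewrite /rate_matrix eq_sym; case: eqP => [->//|_]; exact: zw_mass_reversible.
Qed.

Lemma rate_finite l : finite_set [set m | rate z z' w w' l m != 0].
Proof.
pose s : seq {ffun 'I_N -> int} :=
  [seq sigval l + std_vec i | i <- enum 'I_N] ++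
  [seq sigval l - std_vec i | i <- enum 'I_N].
apply: (@sub_finite_set _ _ ((@sigval N) @^-1` [set` s])); last first.
  apply: finite_preimage; [by move=> a b _ _; exact: val_inj|exact: finite_seq].
move=> m /=; apply: contraNT => ms; rewrite /rate big1// => i _.
have not_in x : x \in s -> sigval m == x = false.
  by move=> xs; apply: contraNF ms => /eqP /= ->.
rewrite !not_in ?addr0// mem_cat; apply/orP; [right|left];
  by apply/mapP; exists i; rewrite ?mem_enum.
Qed.

Lemma rate_matrix_finite l : finite_set [set m | rate_matrix z z' w w' l m != 0].
Proof.
apply: (@sub_finite_set _ _ ([set l] `|` [set m | rate z z' w w' l m != 0])).
  by move=> m /=; rewrite /rate_matrix; case: (m =P l) => [ml _|_ lm]; [left|right].
by rewrite finite_setU; split; [exact: finite_set1|exact: rate_finite].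
Qed.

Lemma rate_matrix_row0 l : \sum_(m \in [set: GT N]) rate_matrix z z' w w' l m = 0.
Proof.
pose s : seq (GT N) :=
  undup (l :: enum_fset (fset_set [set m | rate z z' w w' l m != 0])).
have us : uniq s by exact: undup_uniq.
have ls : l \in s by rewrite mem_undup mem_head.
have rate_supp m : rate z z' w w' l m != 0 -> m \in s.
  move=> lm; rewrite mem_undup inE in_fset_set; last exact: rate_finite.
  by rewrite mem_set// orbT.
have supp m : rate_matrix z z' w w' l m != 0 -> m \in s.
  by rewrite /rate_matrix; case: (m =P l) => [->//|_]; exact: rate_supp.
rewrite (fsbig_support us supp) (bigD1_seq l)//= {1}/rate_matrix eqxx.
rewrite fsbig_mkcond (fsbig_support us); last first.
  move=> m; rewrite patchE; case: ifP => _; [exact: rate_supp|by rewrite eqxx].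
apply/eqP; rewrite addrC subr_eq0; apply/eqP; rewrite big_mkcond/=.
apply: eq_bigr => m _; rewrite patchE /rate_matrix.
by case: ifPn => ml; [rewrite (negbTE ml) mem_set|rewrite memNset//=; exact/negP].
Qed.

End rates.

(** * Connectivity of the jump graph *)

Section connectivity.
Context (N : nat).
Implicit Types (l m : GT N) (i j k : 'I_N).

Lemma add_std_vecE l i j : (sigval l + std_vec i) j = l j + (j == i)%:R.
Proof. by rewrite !ffunE. Qed.

Lemma sub_std_vecE l i j : (sigval l - std_vec i) j = l j - (j == i)%:R.
Proof. by rewrite !ffunE. Qed.

Lemma sigval_antiP (f : {ffun 'I_N -> int}) :
  (forall a b : 'I_N, (a <= b)%N -> f b <= f a) -> exists m, sigval m = f.
Proof.
move=> fP; suff sigP : [forall a : 'I_N, forall b : 'I_N, (a <= b)%N ==> (f b <= f a)].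
  by exists (Signature sigP).
by apply/'forall_'forall_implyP.
Qed.

Lemma covers_up_exists l i : (forall j, (j < i)%N -> l i < l j) ->
  exists m, covers l m i.
Proof.
move=> li; have [|m mE] := @sigval_antiP (sigval l + std_vec i); last by exists m.
move=> a b ab; rewrite !add_std_vecE; have := sig_anti l ab.
have [->|ai] := eqVneq a i; first by case: (b == i); lia.
have [bi|_] := eqVneq b i; last by rewrite !addr0.
rewrite bi in ab *; have /li : (a < i)%N by rewrite ltn_neqAle ai.
lia.
Qed.

Lemma covers_down_exists l i : (forall j, (i < j)%N -> l j < l i) ->
  exists m, covers m l i.
Proof.
move=> li; have [|m mE] := @sigval_antiP (sigval l - std_vec i); last first.
  by exists m; rewrite /covers mE subrK.
move=> a b ab; rewrite !sub_std_vecE; have := sig_anti l ab.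
have [->|bi] := eqVneq b i; first by case: (a == i) => ?; lia.
have [ai|_] := eqVneq a i; last by rewrite !subr0.
rewrite ai in ab *; have /li : (i < b)%N by rewrite ltn_neqAle eq_sym bi.
lia.
Qed.

Definition sig_dist l m : nat := \sum_(i < N) `|l i - m i|%N.

Lemma sig_dist_lt l l' m i :
  (forall j, j != i -> l' j = l j) -> (`|l' i - m i| < `|l i - m i|)%N ->
  (sig_dist l' m < sig_dist l m)%N.
Proof.
move=> ll' lt_i; rewrite /sig_dist (bigD1 i)//= [X in (_ < X)%N](bigD1 i)//=.
rewrite (eq_bigr (fun j => `|l j - m j|%N)) ?ltn_add2r// => j ji.
by rewrite ll'.
Qed.

(** Move [l] towards [m] in the first row where [l] is too short, or, if there
    is none, in the last row where it is too long: this choice of the row keeps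
    the coordinates ordered. *)
Lemma sig_step l m : l != m -> exists l' i,
  (covers l l' i \/ covers l' l i) /\ (sig_dist l' m < sig_dist l m)%N.
Proof.
move=> lm.
have [[i0 i0P]|no_lt] := pselect (exists i, l i < m i).
  have [i li imin] := @arg_minnP _ i0 (fun i => l i < m i) (fun i => i : nat) i0P.
  have [j ji|l' ll'] := @covers_up_exists l i.
    have : ~~ (l j < m j) by apply: contraL ji => /imin; rewrite -leqNgt.
    have := sig_anti m (ltnW ji); move: li; lia.
  exists l', i; split; [by left|apply: (@sig_dist_lt _ _ _ i)].
    by move=> j ji; rewrite (coversE ll') (negbTE ji) addr0.
  by rewrite (coversE ll') eqxx; move: li; lia.
have ml i : m i <= l i by rewrite leNgt; apply/negP => ?; apply: no_lt; exists i.
have [i0 i0P] : exists i, m i < l i.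
  apply: contrapT => no_gt; move/eqP: lm; apply; apply: val_inj; apply/ffunP => i /=.
  apply/eqP; rewrite eq_le ml andbT leNgt; apply/negP => ?.
  by apply: no_gt; exists i.
have [i li imax] := @arg_maxnP _ i0 (fun i => m i < l i) (fun i => i : nat) i0P.
have [j ij|l' ll'] := @covers_down_exists l i.
  have : ~~ (m j < l j) by apply: contraL ij => /imax; rewrite -leqNgt.
  have := sig_anti m (ltnW ij); move: li; lia.
exists l', i; split; [by right|apply: (@sig_dist_lt _ _ _ i)].
  by move=> j ji; rewrite (coversE ll') (negbTE ji) addr0.
by move: li; rewrite (coversE ll') eqxx; lia.
Qed.

Lemma sig_connected (e : rel (GT N)) :
  (forall l m i, covers l m i -> e l m /\ e m l) ->
  forall l m, exists2 s : seq (GT N), path e l s & m = last l s.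
Proof.
move=> e_covers l m; have [n] := ubnP (sig_dist l m).
elim: n l => // n IH l; rewrite ltnS => ln.
have [->|lm] := eqVneq l m; first by exists [::].
have [l' [i [ll' dist_lt]]] := sig_step lm.
have [|s l's ms] := IH l'; first exact: leq_trans ln.
exists (l' :: s) => //=; rewrite l's andbT.
by case: ll' => /e_covers[].
Qed.

End connectivity.

(** * Laws transported by Markov kernels *)

Section transported_law.
Context d d' (X : measurableType d) (Y : measurableType d') (R : realType).
Variables (mu : probability X R) (K : R.-pker X ~> Y).

Let law_cst : unit -> pprobability X R := fun=> mu.

Let measurable_law_cst : measurable_fun setT law_cst.
Proof. exact: measurable_cst. Qed.

(** Written as a composition with a constant kernel, so that integration against
    it is an instance of integration against a composition of kernels. *)
Definition transport : set Y -> \bar R :=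
  kcomp (kprobability measurable_law_cst) (kernel.kernel_snd K) tt.

Lemma transportE A : transport A = (\int[mu]_x K x A)%E.
Proof. by []. Qed.

HB.instance Definition _ := Measure.copy transport
  (mkcomp (kprobability measurable_law_cst) (kernel.kernel_snd K) tt).

Let transport_setT : transport setT = 1%E.
Proof.
rewrite transportE; under eq_integral do rewrite prob_kernel.
by rewrite integral_cst// mul1e; exact: probability_setT.
Qed.

HB.instance Definition _ := Measure_isProbability.Build _ _ _ transport transport_setT.

Definition transported : probability Y R := transport.

Lemma transportedE A : transported A = (\int[mu]_x K x A)%E.
Proof. by []. Qed.

Lemma integral_transported (f : Y -> \bar R) :
  (forall y, 0 <= f y)%E -> measurable_fun setT f ->
  (\int[transported]_y f y = \int[mu]_x \int[K x]_y f y)%E.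
Proof.
move=> f0 mf.
by rewrite [LHS](integral_kcomp (kprobability measurable_law_cst)
  (kernel.kernel_snd K)).
Qed.

End transported_law.

Lemma integral_countable_esum d (T : measurableType d) (R : realType)
    (code : T -> nat) (mu : {measure set T -> \bar R}) (f : T -> \bar R) :
  injective code -> (forall A : set T, measurable A) -> (forall x, 0 <= f x)%E ->
  (\int[mu]_x f x = \esum_(x in [set: T]) (f x * mu [set x]))%E.
Proof.
move=> code_inj mT f0.
pose F k := [set x | code x = k].
have FT : \bigcup_k F k = setT by apply/seteqP; split => // x _; exists (code x).
have tF : trivIset setT F.
  apply/trivIsetP => i j _ _ ij; apply/seteqP; split => // x [/= xi xj].
  by move: ij; rewrite -xi -xj eqxx.
have mf A : measurable_fun A f by move=> mA Y mY; exact: mT.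
rewrite -FT ge0_integral_bigcup// nneseries_esumT; last first.
  by move=> k; exact: integral_ge0.
rewrite esum_bigcupT//; last by move=> x; rewrite mule_ge0.
apply: eq_esum => k _.
have [->|/set0P[x Fx]] := eqVneq (F k) set0; first by rewrite integral_set0 esum_set0.
have -> : F k = [set x].
  apply/seteqP; split=> [y Fy|y ->//]; apply: code_inj.
  by rewrite Fx Fy.
rewrite esum_set1 ?mule_ge0//.
rewrite (eq_integral (cst (f x))); first by rewrite integral_cst.
by move=> y /set_mem ->.
Qed.

HB.instance Definition _ N := [Countable of GT N by <:].

Section signature_laws.
Context (R : realType) (N : nat).

Lemma integral_GT (mu : {measure set (GT N) -> \bar R}) (f : GT N -> \bar R) :
  (forall x, 0 <= f x)%E ->
  (\int[mu]_x f x = \esum_(x in [set: GT N]) (f x * mu [set x]))%E.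
Proof.
move=> f0; apply: (@integral_countable_esum _ (GT N) R choice.pickle) => //.
Qed.

Definition mass (mu : {measure set (GT N) -> \bar R}) (l : GT N) : R :=
  fine (mu [set l]).

Lemma mass_ge0 (mu : {measure set (GT N) -> \bar R}) l : 0 <= mass mu l.
Proof. by rewrite fine_ge0. Qed.

Lemma massE (mu : {measure set (GT N) -> \bar R}) l : mu setT = 1%E ->
  (mass mu l)%:E = mu [set l].
Proof.
move=> mu1; rewrite fineK// ge0_fin_numE//.
apply: (@le_lt_trans _ _ (mu setT)); last by rewrite mu1 ltry.
by apply: le_measure => //; exact/mem_set.
Qed.

Lemma sum_mass (mu : {measure set (GT N) -> \bar R}) : mu setT = 1%E ->
  \esum_(l in [set: GT N]) (mass mu l)%:E = 1%:E.
Proof.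
move=> mu1; rewrite -[RHS]mu1 -[RHS]mul1e -integral_cst// integral_GT//.
by apply: eq_esum => l _; rewrite massE// mul1e.
Qed.

End signature_laws.

(** * The invariant laws at level N and on Omega *)

Section level_chain.
Context (R : realType) (z z' w w' : R[i]).
Hypothesis hz : forall k : int, 0 < (z + k%:~R) * (z' + k%:~R).
Hypothesis hw : forall k : int, 0 < (w + k%:~R) * (w' + k%:~R).
Context (N : nat) (Q : R -> R.-pker (GT N) ~> (GT N)).
Hypothesis Qmin :
  minimal_nonneg_solution (rate_matrix z z' w w' (N:=N)) (kernel_entry Q).

Let Q_sum1 t l : 0 <= t ->
  \esum_(m in [set: GT N]) (kernel_entry Q t l m)%:E = 1%:E.
Proof. by move=> _; apply: sum_mass; exact: prob_kernel. Qed.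

Let Q_nneg t l m : 0 <= t -> 0 <= kernel_entry Q t l m.
Proof. by move=> _; exact: fine_ge0. Qed.

(** Rates of the order of the square of the coordinates are in general not
    integrable with respect to the zw-measure, so that invariance cannot be read
    off by differentiating under the sum; it comes from the reversibility of the
    transition function itself. *)
Lemma zw_mass_invariant : (forall l : GT N, 0 <= zw_mass z z' w w' l) ->
  invariant_mass (kernel_entry Q) (zw_mass z z' w w' (N:=N)).
Proof.
move=> pi0; apply: (reversible_invariant_mass pi0 Q_nneg Q_sum1) => t l m t0.
apply: (minimal_solution_reversible _ _ _ Qmin Q_sum1) => //.
- exact: rate_matrix_offdiag_ge0.
- exact: rate_matrix_finite.
- exact: rate_matrix_row0.
- exact: rate_matrix_reversible.
Qed.

Lemma zw_mass_unique (mu : GT N -> R) :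
  (forall l : GT N, 0 <= zw_mass z z' w w' l) ->
  \esum_(l in [set: GT N]) (zw_mass z z' w w' l)%:E = 1%:E ->
  (forall l, 0 <= mu l) -> \esum_(l in [set: GT N]) (mu l)%:E = 1%:E ->
  invariant_mass (kernel_entry Q) mu -> mu = zw_mass z z' w w' (N:=N).
Proof.
move=> pi0 pi1 mu0 mu1 mui; apply/funext.
apply: (invariant_mass_unique Qmin.1 Q_sum1) => //; last exact: zw_mass_invariant.
apply: (@sig_connected N (fun l m => 0 < rate_matrix z z' w w' l m)).
exact: rate_matrix_covers_gt0.
Qed.

Lemma invariant_massE (nu : {measure set (GT N) -> \bar R}) : nu setT = 1%E ->
  invariant_mass (kernel_entry Q) (mass nu) <->
  forall t l, 0 <= t -> (\int[nu]_m Q t m [set l] = nu [set l])%E.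
Proof.
move=> nu1.
have intE t l : 0 <= t -> (\int[nu]_m Q t m [set l] =
    \esum_(m in [set: GT N]) (mass nu m * kernel_entry Q t m l)%:E)%E.
  move=> t0; rewrite integral_GT//; apply: eq_esum => m _.
  have Q1 : Q t m setT = 1%E by exact: prob_kernel.
  by rewrite muleC EFinM massE// -(massE l Q1).
split=> [nui t l t0|nui t l t0]; first by rewrite intE// nui// massE.
by rewrite -intE// nui// massE.
Qed.

End level_chain.

Section evolution.
Context (R : realType) (Lam : forall N, R.-pker (Omega R) ~> (GT N))
  (PN : forall N, R -> R.-pker (GT N) ~> (GT N))
  (P : R -> R.-pker (Omega R) ~> (Omega R)).
Hypothesis P_Lam : intertwines P Lam PN.

(** The intertwining relation after integration with respect to [mu]: evolving
    on [Omega] and projecting to level [N] is projecting and evolving there. *)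
Lemma projection_evolution (mu : probability (Omega R) R) t N (l : GT N) :
  0 <= t -> (0 < N)%N ->
  (\int[transported mu (P t)]_om Lam N om [set l] =
   \int[transported mu (Lam N)]_m PN N t m [set l])%E.
Proof.
move=> t0 N0; rewrite !integral_transported//; last first.
  by apply: measurable_kernel.
by apply: eq_integral => om _; exact: P_Lam.
Qed.

End evolution.


Theorem theorem7p2 (R : realType) (z z' w w' : R[i])
  (hz : forall k : int, 0 < (z + k%:~R) * (z' + k%:~R))
  (hw : forall k : int, 0 < (w + k%:~R) * (w' + k%:~R))
  (hs : -1 < z + z' + w + w')
  (phi : Omega R -> int -> R)
  (hphi : forall om, laurent_expansion (Phi om) (phi om))
  (Lam : forall N : nat, R.-pker (Omega R) ~> (GT N))
  (hLam : forall (N : nat) (om : Omega R) (l : GT N), (0 < N)%N ->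
     Lam N om [set l] = (Lambda_entry (phi om) l)%:E)
  (PN : forall N : nat, R -> R.-pker (GT N) ~> (GT N))
  (hPN : forall N : nat, (0 < N)%N ->
     minimal_nonneg_solution (rate_matrix z z' w w' (N:=N))
       (kernel_entry (PN N)))
  (P : R -> R.-pker (Omega R) ~> (Omega R))
  (hP : is_the_intertwining_semigroup Lam PN P)
  (M : probability (Omega R) R)
  (hM : is_the_spectral_zw_measure z z' w w' Lam M) :
  invariant_measure P M /\
  forall mu : probability (Omega R) R, invariant_measure P mu ->
    forall A, measurable A -> mu A = M A.
Proof.
have [M_proj M_unique] := hM; have [_ P_Lam _] := hP.
pose law (mu : probability (Omega R) R) N := transported mu (Lam N).
have law1 mu N : law mu N setT = 1%E by exact: probability_setT.
(* Being the law of a projection of [M], the family [zw_mass] is nonnegative with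
   total mass 1, which controls its normalizing constant. *)
have MN N (N0 : (0 < N)%N) : mass (law M N) = zw_mass z z' w w' (N:=N).
  by apply/funext => l; rewrite /mass [X in fine X](M_proj N l N0).
have pi0 N (N0 : (0 < N)%N) (l : GT N) : 0 <= zw_mass z z' w w' l.
  by rewrite -MN// mass_ge0.
have pi1 N (N0 : (0 < N)%N) :
    \esum_(l in [set: GT N]) (zw_mass z z' w w' l)%:E = 1%:E.
  by rewrite -(sum_mass (law1 M N)); apply: eq_esum => l _; rewrite (MN N N0).
split=> [t A t0 mA|mu mu_inv].
  apply: (M_unique (transported M (P t)) _ A mA) => N l N0.
  rewrite (projection_evolution P_Lam)//.
  have zw_inv : invariant_mass (kernel_entry (PN N)) (mass (law M N)).
    by rewrite (MN N N0); exact: (zw_mass_invariant hz hw (hPN N N0) (pi0 N N0)).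
  have /(_ t l t0) -> := (invariant_massE (PN N) (law1 M N)).1 zw_inv.
  exact: M_proj.
move=> A mA; apply: M_unique mA => N l N0.
have law_zw : mass (law mu N) = zw_mass z z' w w' (N:=N); last first.
  by rewrite -law_zw (massE l (law1 mu N)) [RHS]transportedE.
apply: (zw_mass_unique hz hw (hPN N N0) (pi0 N N0) (pi1 N N0) (mu := mass (law mu N))).
- by move=> m; exact: mass_ge0.
- exact: sum_mass (law1 mu N).
apply/(invariant_massE (PN N) (law1 mu N)) => t m t0.
rewrite -(projection_evolution P_Lam)//; apply: eq_measure_integral => B mB _.
exact: mu_inv.
Qed.
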